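(* Let $u$ and $w$ be two vertices of the half-$\theta_6$-graph, with $w$ in a positive cone of $u$. Let $m$ be the midpoint of the side of the canonical triangle $T_{uw}$ opposing $u$, and let $\alpha$ be the unsigned angle between the segment $uw$ and the segment $um$ (so $\alpha \in [0,\pi/6]$). There is a deterministic $1$-local $0$-memory routing algorithm on the half-$\theta_6$-graph for which every path followed has length at most (i) $(\sqrt{3}\cdot\cos\alpha + \sin\alpha)\cdot |uw|$ when routing from $u$ to $w$, (ii) $(5/\sqrt{3}\cdot\cos\alpha - \sin\alpha)\cdot |uw|$ when routing from $w$ to $u$, and these bounds are best possible for deterministic $k$-local, $0$-memory routing algorithms, where $k$ is constant.
   Context: Let $P$ be a set of points in the plane, no two on a line parallel to a cone boundary. Around each point $u$, the plane is partitioned into 6 cones with apex $u$, bounded by rays at consecutive multiples of $\pi/3$ from the positive $x$-axis; in counter-clockwise order starting from the positive $x$-axis they are labelled $\overline{C}_1, C_0, \overline{C}_2, C_1, \overline{C}_0, C_2$. The cones $C_0, C_1, C_2$ are positive, the others negative. The half-$\theta_6$-graph connects each vertex $u$, in each of its positive cones, to the vertex whose orthogonal projection onto the bisector of that cone is closest to $u$. For $v$ in a positive cone of $u$, the canonical triangle $T_{uv}$ is the (equilateral) triangle bounded by that cone of $u$ and the line through $v$ perpendicular to the cone's bisector. A routing algorithm is deterministic $k$-local $m$-memory if the vertex to which a message is forwarded from the current vertex $s$ is a function only of $s$, the destination $t$, the $k$-neighborhood of $s$ (vertices reachable from $s$ by at most $k$ edges), and a memory of size $m$ stored with the message (a unit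 of memory being a $\log_2 n$-bit integer or a point in $\mathbb{R}^2$). Edge lengths are Euclidean. *)

(* Defs.v *)
From Stdlib Require Import Reals Lra List.
Open Scope R_scope.

Definition point : Type := (R * R)%type.

Definition dot (p q : point) : R := fst p * fst q + snd p * snd q.
Definition vsub (p q : point) : point := (fst p - fst q, snd p - snd q).
Definition norm (p : point) : R := sqrt (dot p p).
Definition edist (p q : point) : R := norm (vsub q p).
Definition dir (theta : R) : point := (cos theta, sin theta).

(** The three cone-boundary directions: rays at multiples of pi/3 lie on the
    lines of direction 0, pi/3, 2pi/3. *)
Definition boundary_dir (j : nat) : point := dir (INR j * PI / 3).

Definition parallel (v d : point) : Prop := fst v * snd d - snd v * fst d = 0.

Definition general_position (P : list point) : Prop :=
  forall p q, In p P -> In q P -> p <> q ->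
    forall j, (j < 3)%nat -> ~ parallel (vsub q p) (boundary_dir j).

(** Positive cones C_0, C_1, C_2.  With the labelling
    C1bar, C0, C2bar, C1, C0bar, C2 (ccw from the positive x-axis, each of
    angle pi/3), the positive cone C_i spans the angles
    [ (2i+1)pi/3 , (2i+2)pi/3 ] (mod 2pi), i.e. its bisector has angle
    pi/2 + 2 i pi/3. *)
Definition bisector (i : nat) : point := dir (PI / 2 + INR i * (2 * PI / 3)).

Definition in_cone (i : nat) (u v : point) : Prop :=
  (i < 3)%nat /\ v <> u /\
  dot (vsub v u) (bisector i) >= cos (PI / 6) * norm (vsub v u).

Definition proj (i : nat) (u v : point) : R := dot (vsub v u) (bisector i).

Definition closest (P : list point) (i : nat) (u v : point) : Prop :=
  In v P /\ in_cone i u v /\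
  forall x, In x P -> in_cone i u x -> proj i u v <= proj i u x.

Definition edge (P : list point) (u v : point) : Prop :=
  In u P /\ In v P /\
  exists i, (i < 3)%nat /\ (closest P i u v \/ closest P i v u).

Fixpoint reach (P : list point) (k : nat) (s x : point) : Prop :=
  match k with
  | O => x = s /\ In s P
  | S k' => reach P k' s x \/ exists y, reach P k' s y /\ edge P y x
  end.

(** A deterministic 0-memory routing algorithm: given the point set, the
    current vertex [s] and the destination [t], it returns the next vertex. *)
Definition router : Type := list point -> point -> point -> point.

Definition valid_router (A : router) : Prop :=
  forall P s t, general_position P -> In s P -> In t P -> s <> t ->
    edge P s (A P s t).

Definition k_local (k : nat) (A : router) : Prop :=
  forall P P' s t, general_position P -> general_position P' ->
    In s P -> In t P -> In s P' -> In t P' ->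
    (forall x, reach P k s x <-> reach P' k s x) ->
    A P s t = A P' s t.

Definition route_pt (A : router) (P : list point) (s t : point) (j : nat) : point :=
  Nat.iter j (fun x => A P x t) s.

Fixpoint route_len (A : router) (P : list point) (s t : point) (n : nat) : R :=
  match n with
  | O => 0
  | S n' => route_len A P s t n' +
            edist (route_pt A P s t n') (route_pt A P s t (S n'))
  end.

Definition first_arrival (A : router) (P : list point) (s t : point) (n : nat) : Prop :=
  route_pt A P s t n = t /\ forall j, (j < n)%nat -> route_pt A P s t j <> t.

Definition routes_within (A : router) (P : list point) (s t : point) (L : R) : Prop :=
  exists n, first_arrival A P s t n /\ route_len A P s t n <= L.

(** Unsigned angle between segment uw and segment um, where m is the midpoint
    of the side of T_uw opposite u (m lies on the bisector of cone C_i). *)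
Definition cone_angle (i : nat) (u w : point) : R :=
  acos (proj i u w / edist u w).

Definition bound_to (a : R) : R := sqrt 3 * cos a + sin a.
Definition bound_from (a : R) : R := 5 / sqrt 3 * cos a - sin a.

(* Main.v *)
Require Import Defs.
From Stdlib Require Import Reals Lra Lia List Arith.
From Stdlib Require Import Classical ClassicalEpsilon FunctionalExtensionality PropExtensionality.
Open Scope R_scope.

(** In the three coordinates [coord i] (scaled distances along the bisectors,
    with sum 0) everything becomes linear: [v] is in the positive cone [C_i] of
    [u] iff the two other coordinates do not increase, [coord i] grows by the
    side length of the canonical triangle, and this side length dominates the
    length of an edge.

    Upper bounds.  If the target [t] is in a positive cone of the current vertex
    [s], take the edge in that cone.  Otherwise [s] is in a cone [C_i] of [t] and
    splits the triangle [T_ts] into a middle part and two side triangles; which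
    of the side triangles are empty is visible from the neighbours of [s].  If
    both are occupied, follow the edge into the smaller one.  If one is empty,
    take the edge into the middle part that is closest to it, or, failing that,
    the edge into the other side; the side triangle on the same side of the next
    vertex is then empty again.  With [G] the side of the triangle and [p], [q]
    the two pieces of the side through [s], the potential [G + max p q] for a
    positive cone, [2 G + min p q] for two occupied sides, and [G] plus the size
    of the other side when one is empty, drops by at least the length of every
    edge followed.

    Lower bounds.  Put [n] points alternately close to the left and right corners
    of the triangle, each slightly below its predecessor.  The bottom vertex is
    adjacent to the last point only, while the [k]-neighbourhood of the top vertex
    does not show on which side the last point lies; so a router can be made to
    start on the wrong side.  A single point on the left gives the upward bound. *)

(** * Triangular coordinates *)

(** The factor [2 / sqrt 3] turns the height of an equilateral triangle into its side, so the gain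
    in [coord i] across a canonical triangle is its side length. *)
Definition coord (i : nat) (p : point) : R := 2 / sqrt 3 * dot p (bisector i).

Definition perm3 (i j k : nat) : Prop :=
  (i < 3)%nat /\ (j < 3)%nat /\ (k < 3)%nat /\ i <> j /\ i <> k /\ j <> k.

Lemma perm3_swap i j k : perm3 i j k -> perm3 i k j.
Proof. unfold perm3; intuition. Qed.

Lemma perm3_rot i j k : perm3 i j k -> perm3 j k i.
Proof. unfold perm3; intuition. Qed.

Lemma perm3_cases i j k : perm3 i j k ->
  (i = 0 /\ j = 1 /\ k = 2 \/ i = 0 /\ j = 2 /\ k = 1 \/
   i = 1 /\ j = 0 /\ k = 2 \/ i = 1 /\ j = 2 /\ k = 0 \/
   i = 2 /\ j = 0 /\ k = 1 \/ i = 2 /\ j = 1 /\ k = 0)%nat.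
Proof.
  unfold perm3; intros (Hi & Hj & Hk & Hij & Hik & Hjk).
  destruct i as [|[|[|i]]], j as [|[|[|j]]]; try lia;
    destruct k as [|[|[|k]]]; intuition lia.
Qed.

Ltac perm_split H :=
  destruct (perm3_cases _ _ _ H) as [E|[E|[E|[E|[E|E]]]]];
  destruct E as (-> & -> & ->).

Lemma perm3_extend i : (i < 3)%nat -> exists j k, perm3 i j k.
Proof.
  intros Hi; unfold perm3.
  destruct i as [|[|[|i]]]; [exists 1%nat, 2%nat|exists 0%nat, 2%nat|exists 0%nat, 1%nat|]; lia.
Qed.

Lemma sqrt3_sq : sqrt 3 * sqrt 3 = 3.
Proof. apply sqrt_sqrt; lra. Qed.

Lemma sqrt3_pos : 0 < sqrt 3.
Proof. apply sqrt_lt_R0; lra. Qed.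

Lemma bisector_0 : bisector 0 = (0, 1).
Proof.
  unfold bisector, dir; simpl.
  replace (PI / 2 + 0 * (2 * PI / 3)) with (PI / 2) by field.
  now rewrite cos_PI2, sin_PI2.
Qed.

Lemma bisector_1 : bisector 1 = (- (sqrt 3 / 2), - (1 / 2)).
Proof.
  unfold bisector, dir; simpl.
  replace (PI / 2 + 1 * (2 * PI / 3)) with (PI / 6 + PI) by field.
  now rewrite neg_cos, neg_sin, cos_PI6, sin_PI6.
Qed.

Lemma bisector_2 : bisector 2 = (sqrt 3 / 2, - (1 / 2)).
Proof.
  unfold bisector, dir.
  replace (PI / 2 + INR 2 * (2 * PI / 3)) with (- (PI / 6) + 2 * INR 1 * PI) by (simpl; field).
  now rewrite cos_period, sin_period, cos_neg, sin_neg, cos_PI6, sin_PI6.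
Qed.

Lemma coord_0 p : coord 0 p = 2 * (snd p / sqrt 3).
Proof.
  unfold coord, dot; rewrite bisector_0; simpl.
  field; pose proof sqrt3_pos; lra.
Qed.

Lemma coord_1 p : coord 1 p = - fst p - snd p / sqrt 3.
Proof.
  unfold coord, dot; rewrite bisector_1; simpl.
  field; pose proof sqrt3_pos; lra.
Qed.

Lemma coord_2 p : coord 2 p = fst p - snd p / sqrt 3.
Proof.
  unfold coord, dot; rewrite bisector_2; simpl.
  field; pose proof sqrt3_pos; lra.
Qed.

Lemma coord_sum i j k p : perm3 i j k -> coord i p + coord j p + coord k p = 0.
Proof.
  intros H; perm_split H; rewrite coord_0, coord_1, coord_2; field;
    pose proof sqrt3_pos; lra.
Qed.

Lemma proj_coord i u v : proj i u v = sqrt 3 / 2 * (coord i v - coord i u).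
Proof.
  unfold proj, coord, dot, vsub; simpl; field; pose proof sqrt3_pos; lra.
Qed.

Lemma edist_nonneg u v : 0 <= edist u v.
Proof. apply sqrt_pos. Qed.

Lemma edist_xy u v : edist u v * edist u v =
  (fst v - fst u) * (fst v - fst u) + (snd v - snd u) * (snd v - snd u).
Proof.
  unfold edist, norm; rewrite sqrt_sqrt; unfold dot, vsub; simpl; [reflexivity|].
  apply Rplus_le_le_0_compat; apply Rle_0_sqr.
Qed.

(** Law of cosines in the frame of the two boundary rays of [C_i], which meet at angle pi/3: along
    each ray only one of the coordinates [j], [k] changes. *)
Lemma edist_coord i j k u v : perm3 i j k ->
  let a := coord j v - coord j u in let b := coord k v - coord k u in
  edist u v * edist u v = a * a + a * b + b * b.
Proof.
  intros H a b; rewrite edist_xy; subst a b.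
  assert (R : 1 / sqrt 3 * (1 / sqrt 3) = 1 / 3).
  { replace (1 / sqrt 3 * (1 / sqrt 3)) with (1 / (sqrt 3 * sqrt 3))
      by (field; pose proof sqrt3_pos; lra).
    now rewrite sqrt3_sq. }
  destruct u as [ux uy], v as [vx vy].
  simpl; replace ((vy - uy) * (vy - uy))
    with (3 * ((vy / sqrt 3 - uy / sqrt 3) * (vy / sqrt 3 - uy / sqrt 3))).
  - perm_split H; rewrite ?coord_0, ?coord_1, ?coord_2; simpl; ring.
  - replace ((vy / sqrt 3 - uy / sqrt 3) * (vy / sqrt 3 - uy / sqrt 3))
      with (1 / sqrt 3 * (1 / sqrt 3) * ((vy - uy) * (vy - uy)))
      by (field; pose proof sqrt3_pos; lra).
    rewrite R; field.
Qed.

Lemma edist_sym u v : edist u v = edist v u.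
Proof.
  unfold edist, norm; f_equal; unfold dot, vsub; simpl; ring.
Qed.

Lemma edist_triangle u v w : edist u w <= edist u v + edist v w.
Proof.
  pose proof (edist_nonneg u v); pose proof (edist_nonneg v w);
  pose proof (edist_nonneg u w).
  pose proof (edist_xy u v) as D1; pose proof (edist_xy v w) as D2;
  pose proof (edist_xy u w) as D3.
  apply Rsqr_incr_0; try lra; unfold Rsqr.
  rewrite D3.
  set (a := fst v - fst u) in *; set (b := snd v - snd u) in *.
  set (c := fst w - fst v) in *; set (d := snd w - snd v) in *.
  replace (fst w - fst u) with (a + c) by (unfold a, c; ring).
  replace (snd w - snd u) with (b + d) by (unfold b, d; ring).
  assert (CS : a * c + b * d <= edist u v * edist v w).
  { apply Rsqr_incr_0_var; [unfold Rsqr|apply Rmult_le_pos; assumption].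
    replace (edist u v * edist v w * (edist u v * edist v w))
      with ((edist u v * edist u v) * (edist v w * edist v w)) by ring.
    rewrite D1, D2; pose proof (Rle_0_sqr (a * d - b * c)); unfold Rsqr in *; nra. }
  nra.
Qed.

Lemma edist_refl u : edist u u = 0.
Proof.
  apply Rsqr_0_uniq; unfold Rsqr; rewrite edist_xy; ring.
Qed.

Lemma edist_eq0 u v : edist u v = 0 -> u = v.
Proof.
  intros E; pose proof (edist_xy u v) as H; rewrite E in H.
  destruct u as [a b], v as [c d]; simpl in *.
  destruct (Rplus_sqr_eq_0 (c - a) (d - b)) as [E1 E2]; [unfold Rsqr; lra|].
  f_equal; lra.
Qed.

Lemma edist_pos u v : u <> v -> 0 < edist u v.
Proof.
  intros N; destruct (edist_nonneg u v) as [|E]; [assumption|].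
  now destruct N; apply edist_eq0.
Qed.

(** With [a], [b] the increments of coordinates [j], [k], the angle condition reads |uv| <= - a - b.
    Squaring leaves a b >= 0, and a + b <= 0 then fixes both signs. *)
Lemma in_cone_coord i j k u v : perm3 i j k ->
  in_cone i u v <->
  v <> u /\ coord j v <= coord j u /\ coord k v <= coord k u.
Proof.
  intros H.
  pose proof (coord_sum _ _ _ u H) as Su; pose proof (coord_sum _ _ _ v H) as Sv.
  pose proof (edist_coord _ _ _ u v H) as D; cbv zeta in D.
  pose proof (proj_coord i u v) as Pr.
  pose proof (edist_nonneg u v) as Dn.
  pose proof sqrt3_pos as S3.
  unfold in_cone; rewrite cos_PI6.
  change (dot (vsub v u) (bisector i)) with (proj i u v).
  change (norm (vsub v u)) with (edist u v).
  rewrite Pr.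
  set (a := coord j v - coord j u) in *; set (b := coord k v - coord k u) in *.
  replace (coord i v - coord i u) with (- a - b) by (unfold a, b; lra).
  assert (E : sqrt 3 / 2 * (- a - b) >= sqrt 3 / 2 * edist u v <-> a <= 0 /\ b <= 0).
  { split.
    - intros G.
      assert (G' : edist u v <= - a - b).
      { apply (Rmult_le_reg_l (sqrt 3 / 2)); lra. }
      assert (0 <= a * b) by nra.
      split; destruct (Rle_dec a 0), (Rle_dec b 0); nra.
    - intros [Ha Hb].
      apply Rle_ge, Rmult_le_compat_l; [lra|].
      apply Rsqr_incr_0_var; [unfold Rsqr|]; nra. }
  rewrite E; unfold a, b.
  destruct H as [Hi _]; intuition lra.
Qed.

Lemma edist_in_cone i u v : in_cone i u v -> edist u v <= coord i v - coord i u.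
Proof.
  intros H.
  destruct (perm3_extend i (proj1 H)) as (j & k & Hp).
  destruct (proj1 (in_cone_coord _ _ _ _ _ Hp) H) as (_ & Hj & Hk).
  pose proof (edist_coord _ _ _ u v Hp) as D; cbv zeta in D.
  pose proof (coord_sum _ _ _ u Hp); pose proof (coord_sum _ _ _ v Hp).
  apply Rsqr_incr_0_var; [unfold Rsqr|lra].
  rewrite D; nra.
Qed.

Lemma boundary_dirs :
  boundary_dir 0 = (1, 0) /\ boundary_dir 1 = (1 / 2, sqrt 3 / 2) /\
  boundary_dir 2 = (- (1 / 2), sqrt 3 / 2).
Proof.
  unfold boundary_dir, dir; repeat split.
  - replace (INR 0 * PI / 3) with 0 by (simpl; field). now rewrite cos_0, sin_0.
  - replace (INR 1 * PI / 3) with (PI / 3) by (simpl; field).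
    now rewrite cos_PI3, sin_PI3.
  - replace (INR 2 * PI / 3) with (PI - PI / 3) by (simpl; field).
    replace (cos (PI - PI / 3)) with (- cos (PI / 3))
      by (rewrite cos_minus, cos_PI, sin_PI; ring).
    replace (sin (PI - PI / 3)) with (sin (PI / 3))
      by (rewrite sin_minus, cos_PI, sin_PI; ring).
    now rewrite cos_PI3, sin_PI3.
Qed.

(** Each boundary line is perpendicular to one bisector, so being parallel to it means agreeing in
    one coordinate: direction 0 goes with [coord 0], pi/3 with [coord 2], 2pi/3 with [coord 1]. *)
Lemma general_position_coord P :
  general_position P <->
  forall p q, In p P -> In q P -> p <> q ->
    forall i, (i < 3)%nat -> coord i p <> coord i q.
Proof.
  destruct boundary_dirs as (B0 & B1 & B2).
  pose proof sqrt3_pos as S3.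
  assert (Q : forall y, y = sqrt 3 * (y / sqrt 3)) by (intros; field; lra).
  assert (E : forall p q, (parallel (vsub q p) (boundary_dir 0) <-> coord 0 p = coord 0 q) /\
    (parallel (vsub q p) (boundary_dir 1) <-> coord 2 p = coord 2 q) /\
    (parallel (vsub q p) (boundary_dir 2) <-> coord 1 p = coord 1 q)).
  { intros [px py] [qx qy]; unfold parallel; rewrite B0, B1, B2.
    rewrite !coord_0, !coord_1, !coord_2; simpl.
    rewrite (Q py), (Q qy) at 1 3 5.
    set (p := py / sqrt 3); set (q := qy / sqrt 3).
    replace (sqrt 3 * p / sqrt 3) with p by (field; lra).
    replace (sqrt 3 * q / sqrt 3) with q by (field; lra).
    repeat split; intros H; try nra. }
  split; intros H p q Hp Hq N.
  - intros i Hi; destruct (E p q) as (E0 & E1 & E2).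
    destruct i as [|[|[|i]]]; [| | |lia].
    + rewrite <- E0; apply H; auto.
    + rewrite <- E2; apply H; auto.
    + rewrite <- E1; apply H; auto.
  - intros j Hj; destruct (E p q) as (E0 & E1 & E2).
    destruct j as [|[|[|j]]]; [| | |lia].
    + rewrite E0; apply H; auto.
    + rewrite E1; apply H; auto.
    + rewrite E2; apply H; auto.
Qed.

(** * The routing algorithm *)

Lemma exists_argmin (l : list point) (Q : point -> Prop) (f : point -> R) :
  (exists x, In x l /\ Q x) ->
  exists x, In x l /\ Q x /\ forall y, In y l -> Q y -> f x <= f y.
Proof.
  induction l as [|a l IH]; intros (x & Hx & Qx); [destruct Hx|].
  destruct (classic (exists x, In x l /\ Q x)) as [H|H].
  - destruct (IH H) as (m & Hm & Qm & Mm).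
    destruct (classic (Q a /\ f a <= f m)) as [[Qa Ha]|N].
    + exists a; repeat split; [now left|assumption|].
      intros y [<-|Hy] Qy; [lra|]. specialize (Mm y Hy Qy); lra.
    + exists m; repeat split; [now right|assumption|].
      intros y [<-|Hy] Qy; [|auto].
      destruct (Rle_dec (f m) (f a)); [assumption|].
      exfalso; apply N; split; [assumption|lra].
  - destruct Hx as [->|Hx]; [|exfalso; eauto].
    exists x; repeat split; [now left|assumption|].
    intros y [<-|Hy] Qy; [lra|exfalso; eauto].
Qed.

(** * Cones and edges under general position *)

Definition distinct_coords (P : list point) : Prop :=
  forall i p q, (i < 3)%nat -> In p P -> In q P -> coord i p = coord i q -> p = q.

Lemma general_position_distinct P : general_position P -> distinct_coords P.
Proof.
  intros H i p q Hi Hp Hq E; apply NNPP; intros N.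
  now apply (proj1 (general_position_coord P) H p q Hp Hq N i Hi).
Qed.

Ltac coord_facts H :=
  repeat match goal with
  | p : point |- _ =>
    lazymatch goal with
    | _ : coord _ p + coord _ p + coord _ p = 0 |- _ => fail
    | _ => pose proof (coord_sum _ _ _ p H)
    end
  end.

(** The three coordinate differences sum to 0, so two share a weak sign; the remaining coordinate
    names the cone, and the sign decides which point is its apex. *)
Lemma cone_or_converse P s t :
  distinct_coords P -> In s P -> In t P -> s <> t ->
  exists i, in_cone i s t \/ in_cone i t s.
Proof.
  intros D Hs Ht N.
  assert (H0 : perm3 0 1 2) by (unfold perm3; lia).
  pose proof (in_cone_coord _ _ _ s t H0) as C0.
  pose proof (in_cone_coord _ _ _ s t (perm3_rot _ _ _ H0)) as C1.
  pose proof (in_cone_coord _ _ _ s t (perm3_rot _ _ _ (perm3_rot _ _ _ H0))) as C2.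
  pose proof (in_cone_coord _ _ _ t s H0) as C0'.
  pose proof (in_cone_coord _ _ _ t s (perm3_rot _ _ _ H0)) as C1'.
  pose proof (in_cone_coord _ _ _ t s (perm3_rot _ _ _ (perm3_rot _ _ _ H0))) as C2'.
  coord_facts H0.
  assert (N' : t <> s) by congruence.
  destruct (Rle_dec (coord 0 s) (coord 0 t)), (Rle_dec (coord 1 s) (coord 1 t)),
    (Rle_dec (coord 2 s) (coord 2 t));
    solve [exists 0%nat; rewrite C0, C0'; intuition lra
          |exists 1%nat; rewrite C1, C1'; intuition lra
          |exists 2%nat; rewrite C2, C2'; intuition lra].
Qed.

Lemma in_cone_strict P i j k u v :
  distinct_coords P -> perm3 i j k -> In u P -> In v P -> in_cone i u v ->
  coord j v < coord j u /\ coord k v < coord k u.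
Proof.
  intros D H Hu Hv Hc.
  destruct (proj1 (in_cone_coord _ _ _ _ _ H) Hc) as (N & Hj & Hk).
  destruct H as (_ & Lj & Lk & _).
  split; apply Rnot_le_lt; intros L; apply N.
  - apply (D j); auto; lra.
  - apply (D k); auto; lra.
Qed.

Lemma in_cone_not_converse P i i' u v :
  distinct_coords P -> In u P -> In v P -> in_cone i u v -> ~ in_cone i' v u.
Proof.
  intros D Hu Hv Hc Hc'.
  destruct (perm3_extend i (proj1 Hc)) as (j & k & H).
  destruct (in_cone_strict _ _ _ _ _ _ D H Hu Hv Hc) as [Lj Lk].
  destruct (perm3_extend i' (proj1 Hc')) as (j' & k' & H').
  destruct (in_cone_strict _ _ _ _ _ _ D H' Hv Hu Hc') as [Lj' Lk'].
  perm_split H; perm_split H'; lra.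
Qed.

Lemma in_cone_unique P i i' u v :
  distinct_coords P -> In u P -> In v P -> in_cone i u v -> in_cone i' u v -> i = i'.
Proof.
  intros D Hu Hv Hc Hc'.
  destruct (perm3_extend i (proj1 Hc)) as (j & k & H).
  destruct (in_cone_strict _ _ _ _ _ _ D H Hu Hv Hc) as [Lj Lk].
  destruct (perm3_extend i' (proj1 Hc')) as (j' & k' & H').
  destruct (in_cone_strict _ _ _ _ _ _ D H' Hu Hv Hc') as [Lj' Lk'].
  pose proof (coord_sum _ _ _ u H); pose proof (coord_sum _ _ _ v H).
  perm_split H; perm_split H'; try reflexivity; lra.
Qed.

Lemma closest_coord P i u v :
  closest P i u v <->
  In v P /\ in_cone i u v /\
  forall x, In x P -> in_cone i u x -> coord i v <= coord i x.
Proof.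
  unfold closest; pose proof sqrt3_pos.
  split; intros (Hv & Hc & Hm); repeat split; try apply Hc; try assumption;
    intros x Hx Hxc; specialize (Hm x Hx Hxc); rewrite !proj_coord in *.
  - apply Rplus_le_reg_r with (- coord i u).
    apply (Rmult_le_reg_l (sqrt 3 / 2)); lra.
  - apply Rmult_le_compat_l; lra.
Qed.

Lemma closest_exists P i u x :
  In x P -> in_cone i u x -> exists v, closest P i u v /\ coord i v <= coord i x.
Proof.
  intros Hx Hc.
  destruct (exists_argmin P (in_cone i u) (coord i)) as (v & Hv & Cv & Mv); [eauto|].
  exists v; rewrite closest_coord; repeat split; try apply Cv; auto.
Qed.

Lemma closest_edge P i u v : In u P -> closest P i u v -> edge P u v.
Proof.
  intros Hu Hc; repeat split; [assumption|apply Hc|].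
  exists i; split; [apply Hc|now left].
Qed.

(** A pair of points determines its cone and which of the two is the apex, so the direction of an
    edge can be read off from the positions of its ends. *)
Lemma edge_closest P i u v :
  distinct_coords P -> edge P u v -> in_cone i u v -> closest P i u v.
Proof.
  intros D (Hu & Hv & i' & Hi' & [Hc|Hc]) H.
  - pose proof (proj1 (proj2 Hc)) as C.
    now rewrite (in_cone_unique P i i' u v D Hu Hv H C).
  - pose proof (proj1 (proj2 Hc)) as C.
    now destruct (in_cone_not_converse P i i' u v D Hu Hv H).
Qed.

Lemma edge_sym P u v : edge P u v -> edge P v u.
Proof.
  intros (Hu & Hv & i & Hi & H); repeat split; [assumption..|].
  exists i; split; [assumption|]; destruct H; auto.
Qed.

Lemma edge_neq P u v : edge P u v -> v <> u.
Proof.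
  intros (_ & _ & i & _ & [(_ & (_ & N & _) & _)|(_ & (_ & N & _) & _)]); congruence.
Qed.

(** Stated through [reach], the form in which locality is given; [reach] contains [s] itself, which
    must be excluded. *)
Definition neighbor (P : list point) (s x : point) : Prop := reach P 1 s x /\ x <> s.

Lemma neighbor_edge P s x : neighbor P s x <-> edge P s x.
Proof.
  unfold neighbor; simpl; split.
  - intros ([[E _]|(y & [-> _] & He)] & N); [contradiction|assumption].
  - intros He; split; [right; exists s; split; [split; [reflexivity|apply He]|assumption]
      |now apply edge_neq in He].
Qed.

(* [side] and [middle] are the three parts into which [s] splits the canonical
   triangle of [t] and [s], when [s] lies in a positive cone of [t]. *)
Definition side (j : nat) (s t x : point) : Prop :=
  in_cone j s x /\ coord j x <= coord j t.

Definition middle (i j k : nat) (s t x : point) : Prop :=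
  in_cone i x s /\ coord j x <= coord j t /\ coord k x <= coord k t.

(** In [step_middle] and [step_side], [j] is the side seen to be empty. If both are empty, the
    disjunction in [step_middle] gives the role of [j] to the larger one, so that the potential
    charges the smaller, whichever side was used before; this replaces memory. *)
Inductive routing_step (N : point -> Prop) (s t v : point) : Prop :=
| step_cone i : in_cone i s t -> in_cone i s v -> routing_step N s t v
| step_two_sides i j k x :
    perm3 i j k -> in_cone i t s -> N x -> side k s t x ->
    coord j t - coord j s <= coord k t - coord k s ->
    side j s t v -> routing_step N s t v
| step_middle i j k :
    perm3 i j k -> in_cone i t s -> (forall x, N x -> ~ side j s t x) ->
    (exists x, N x /\ side k s t x) \/ coord k t - coord k s <= coord j t - coord j s ->
    (forall x, N x -> middle i j k s t x -> coord k v <= coord k x) ->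
    middle i j k s t v -> routing_step N s t v
| step_side i j k :
    perm3 i j k -> in_cone i t s -> (forall x, N x -> ~ side j s t x) ->
    (forall x, N x -> ~ middle i j k s t x) ->
    side k s t v -> routing_step N s t v.

Lemma side_neighbor P j s t x :
  In s P -> In x P -> side j s t x -> exists y, closest P j s y /\ side j s t y.
Proof.
  intros Hs Hx [Hc Hl]; destruct (closest_exists P j s x Hx Hc) as (y & Hy & Ly).
  exists y; split; [assumption|]; split; [apply Hy|lra].
Qed.

Lemma side_empty P j s t :
  In s P -> (forall x, edge P s x -> ~ side j s t x) ->
  forall x, In x P -> ~ side j s t x.
Proof.
  intros Hs H x Hx Hsd; destruct (side_neighbor P j s t x Hs Hx Hsd) as (y & Cy & Sy).
  apply (H y); [eapply closest_edge; eauto|assumption].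
Qed.

(** * Destination in a negative cone: existing edges and regions that stay empty *)

Section Negative.

Variables (P : list point) (i j k : nat) (s t : point).
Hypotheses (D : distinct_coords P) (Hp : perm3 i j k) (Hs : In s P) (Ht : In t P)
  (Hts : in_cone i t s) (Ej : forall x, In x P -> ~ side j s t x).

(** The point [t] lies in the middle part, so a minimum exists. A small [coord k] means close to the
    empty side [j]. *)
Lemma middle_argmin : exists z, In z P /\ middle i j k s t z /\
  forall y, In y P -> middle i j k s t y -> coord k z <= coord k y.
Proof.
  apply exists_argmin; exists t; repeat split; try apply Hts; try assumption; lra.
Qed.

(** A point spoiling the edge would lie in [C_i] of [z], nearer than [s]. Seen from [s] it is in
    side [k], in the empty side [j], or in the middle with smaller [coord k] than [z]; each is
    excluded. *)
Lemma middle_argmin_edge z :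
  In z P -> middle i j k s t z ->
  (forall y, In y P -> middle i j k s t y -> coord k z <= coord k y) ->
  (forall x, In x P -> side k s t x -> coord k z < coord k x) ->
  edge P s z.
Proof.
  intros Hz Mz Min Hk.
  apply edge_sym, (closest_edge P i z s Hz), closest_coord.
  split; [assumption|split; [apply Mz|]].
  intros x Hx Cx; apply Rnot_lt_le; intros L.
  destruct (in_cone_strict P i j k z x D Hp Hz Hx Cx) as [Lj Lk].
  destruct Mz as (Cz & Mj & Mk).
  destruct (in_cone_strict P i j k z s D Hp Hz Hs Cz) as [Sj Sk].
  assert (N : x <> s) by (intros ->; lra).
  assert (N' : s <> x) by congruence.
  pose proof (perm3_rot _ _ _ Hp) as Hp'; pose proof (perm3_rot _ _ _ Hp') as Hp''.
  coord_facts Hp.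
  destruct (Rle_dec (coord j x) (coord j s)).
  - assert (K : side k s t x).
    { split; [rewrite (in_cone_coord _ _ _ _ _ Hp''); repeat split|]; try assumption; lra. }
    specialize (Hk x Hx K); lra.
  - destruct (Rle_dec (coord k x) (coord k s)).
    + apply (Ej x Hx); split; [rewrite (in_cone_coord _ _ _ _ _ Hp'); repeat split|];
        try assumption; lra.
    + assert (M : middle i j k s t x).
      { split; [rewrite (in_cone_coord _ _ _ _ _ Hp); repeat split|split];
          try assumption; lra. }
      specialize (Min x Hx M); lra.
Qed.

(** A point [y] of the new side lies in the old empty side or in the middle. In the latter case the
    minimiser [z] of [coord k] over the middle lies closer to side [j] than [v] and is a neighbour
    of [s], against the choice of [v]. *)
Lemma middle_step_empty v :
  edge P s v -> middle i j k s t v ->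
  (forall x, edge P s x -> middle i j k s t x -> coord k v <= coord k x) ->
  forall y, In y P -> ~ side j v t y.
Proof.
  intros Ev Mv Min y Hy [Cy Ly].
  assert (Hv : In v P) by apply Ev.
  pose proof (perm3_rot _ _ _ Hp) as Hp'; pose proof (perm3_rot _ _ _ Hp') as Hp''.
  destruct (in_cone_strict P j k i v y D Hp' Hv Hy Cy) as [Yk Yi].
  pose proof Mv as (Cv & Mj & Mk).
  destruct (in_cone_strict P i j k v s D Hp Hv Hs Cv) as [Sj Sk].
  pose proof (edge_closest P i v s D (edge_sym _ _ _ Ev) Cv) as Cl.
  apply closest_coord in Cl as (_ & _ & Cl).
  coord_facts Hp.
  assert (N : y <> s) by (intros ->; lra).
  assert (N' : s <> y) by congruence.
  destruct (Rle_dec (coord k y) (coord k s)).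
  - apply (Ej y Hy); split; [rewrite (in_cone_coord _ _ _ _ _ Hp'); repeat split|];
      try assumption; lra.
  - assert (My : middle i j k s t y).
    { split; [rewrite (in_cone_coord _ _ _ _ _ Hp); repeat split|split];
          try assumption; lra. }
    destruct middle_argmin as (z & Hz & Mz & Mmin).
    pose proof (Mmin y Hy My).
    assert (Ez : edge P s z).
    (* A point of side [k] whose [coord k] is at most that of [z] would lie in [C_i] of [v], nearer
       than [s], against the edge between [v] and [s]. *)
    { apply middle_argmin_edge; auto.
      intros x Hx [Cx Lx]; apply Rnot_le_lt; intros L.
      destruct (in_cone_strict P k i j s x D Hp'' Hs Hx Cx) as [Xi Xj].
      enough (coord i s <= coord i x) by lra.
      apply Cl; [assumption|]; rewrite (in_cone_coord _ _ _ _ _ Hp); repeat split; try lra.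
      intros ->; lra. }
    specialize (Min z Ez Mz); lra.
Qed.

(** A point [y] of the new side would be in [C_k] of [s] and nearer than [v], or in the old empty
    side, or in the middle. In the last case all points of side [k] have larger [coord k] than [y],
    so [s] would have a neighbour in the middle. *)
Lemma side_step_empty v :
  edge P s v -> side k s t v ->
  (forall x, edge P s x -> ~ middle i j k s t x) ->
  forall y, In y P -> ~ side j v t y.
Proof.
  intros Ev [Cv Kv] NM y Hy [Cy Ly].
  assert (Hv : In v P) by apply Ev.
  pose proof (perm3_rot _ _ _ Hp) as Hp'; pose proof (perm3_rot _ _ _ Hp') as Hp''.
  destruct (in_cone_strict P j k i v y D Hp' Hv Hy Cy) as [Yk Yi].
  destruct (in_cone_strict P k i j s v D Hp'' Hs Hv Cv) as [Sj Sk].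
  pose proof (edge_closest P k s v D Ev Cv) as Cl.
  apply closest_coord in Cl as (_ & _ & Cl).
  coord_facts Hp.
  assert (N : y <> s) by (intros ->; lra).
  assert (N' : s <> y) by congruence.
  destruct (Rle_dec (coord j y) (coord j s)).
  - enough (coord k v <= coord k y) by lra.
    apply Cl; [assumption|]; rewrite (in_cone_coord _ _ _ _ _ Hp'');
      repeat split; try assumption; lra.
  - destruct (Rle_dec (coord k y) (coord k s)).
    + apply (Ej y Hy); split; [rewrite (in_cone_coord _ _ _ _ _ Hp'); repeat split|];
        try assumption; lra.
    + assert (My : middle i j k s t y).
      { split; [rewrite (in_cone_coord _ _ _ _ _ Hp); repeat split|split];
          try assumption; lra. }
      destruct middle_argmin as (z & Hz & Mz & Mmin).
      pose proof (Mmin y Hy My).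
      apply (NM z); [|assumption].
      apply middle_argmin_edge; auto.
      intros x Hx [Cx _]; specialize (Cl x Hx Cx); lra.
Qed.

Lemma middle_or_side_neighbor :
  (exists x, edge P s x /\ middle i j k s t x) \/ (exists x, edge P s x /\ side k s t x).
Proof.
  destruct (classic (exists x, In x P /\ side k s t x)) as [(x & Hx & Sx)|NS].
  - right; destruct (side_neighbor P k s t x Hs Hx Sx) as (y & Cy & Sy).
    exists y; split; [eapply closest_edge; eauto|assumption].
  - left; destruct middle_argmin as (z & Hz & Mz & Mmin).
    exists z; split; [|assumption].
    apply middle_argmin_edge; auto.
    intros x Hx Sx; exfalso; eauto.
Qed.

End Negative.

Lemma routing_step_exists P s t :
  distinct_coords P -> In s P -> In t P -> s <> t ->
  exists v, edge P s v /\ routing_step (edge P s) s t v.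
Proof.
  intros D Hs Ht N.
  destruct (cone_or_converse P s t D Hs Ht N) as [i [Hc|Hc]].
  { destruct (closest_exists P i s t Ht Hc) as (v & Cv & _).
    exists v; split; [eapply closest_edge; eauto|].
    eapply step_cone; [apply Hc|apply Cv]. }
  assert (One : forall j k, perm3 i j k -> (forall x, edge P s x -> ~ side j s t x) ->
    (exists x, edge P s x /\ side k s t x) \/
      coord k t - coord k s <= coord j t - coord j s ->
    exists v, edge P s v /\ routing_step (edge P s) s t v).
  { intros j k Hp Ej Hk.
    destruct (classic (exists x, edge P s x /\ middle i j k s t x)) as [(x & Ex & Mx)|NM].
    - destruct (exists_argmin P (fun x => edge P s x /\ middle i j k s t x) (coord k))
        as (v & Hv & [Ev Mv] & Min); [exists x; split; [apply Ex|auto]|].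
      exists v; split; [assumption|].
      apply (step_middle _ _ _ _ i j k); auto.
      intros y Ey My; apply Min; [apply Ey|auto].
    - destruct (middle_or_side_neighbor P i j k s t D Hp Hs Ht Hc (side_empty P j s t Hs Ej))
        as [M|(x & Ex & Sx)]; [contradiction|].
      exists x; split; [assumption|].
      apply (step_side _ _ _ _ i j k); auto.
      intros y Ey My; apply NM; eauto. }
  destruct (perm3_extend i (proj1 Hc)) as (j & k & Hp).
  pose proof (perm3_swap _ _ _ Hp) as Hq.
  destruct (classic (exists x, edge P s x /\ side j s t x)) as [(x & Ex & Sx)|Nj];
  destruct (classic (exists x, edge P s x /\ side k s t x)) as [(y & Ey & Sy)|Nk].
  - destruct (Rle_dec (coord j t - coord j s) (coord k t - coord k s)).
    + exists x; split; [assumption|]; now apply (step_two_sides _ _ _ _ i j k y).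
    + exists y; split; [assumption|]; apply (step_two_sides _ _ _ _ i k j x); auto; lra.
  - apply (One k j); [assumption|intros y Hy Sy; eauto|left; eauto].
  - apply (One j k); [assumption|intros x Hx Sx; eauto|left; eauto].
  - destruct (Rle_dec (coord k t - coord k s) (coord j t - coord j s)).
    + apply (One j k); [assumption|intros x Hx Sx; eauto|now right].
    + apply (One k j); [assumption|intros x Hx Sx; eauto|right; lra].
Qed.

(* The choice depends on [P] only through the set of neighbours of [s], which
   makes 1-locality a matter of extensionality. *)
Definition theta_router : router := fun P s t =>
  epsilon (inhabits s) (fun v => neighbor P s v /\ routing_step (neighbor P s) s t v).

Lemma neighbor_edge_eq P s : neighbor P s = edge P s.
Proof.
  apply functional_extensionality; intros x; apply propositional_extensionality.
  apply neighbor_edge.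
Qed.

Lemma theta_router_spec P s t :
  distinct_coords P -> In s P -> In t P -> s <> t ->
  edge P s (theta_router P s t) /\ routing_step (edge P s) s t (theta_router P s t).
Proof.
  intros D Hs Ht N; unfold theta_router; rewrite neighbor_edge_eq.
  apply (epsilon_spec (inhabits s) (fun v => edge P s v /\ routing_step (edge P s) s t v)).
  now apply routing_step_exists.
Qed.

Lemma theta_router_valid : valid_router theta_router.
Proof.
  intros P s t G Hs Ht N.
  apply theta_router_spec; auto using general_position_distinct.
Qed.

Lemma theta_router_local : k_local 1 theta_router.
Proof.
  intros P P' s t _ _ _ _ _ _ H; unfold theta_router.
  replace (neighbor P' s) with (neighbor P s); [reflexivity|].
  apply functional_extensionality; intros x; apply propositional_extensionality.
  unfold neighbor; now rewrite H.
Qed.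

(** * Potential *)

(** [B] is an upper bound for the potential, not its value, so any constructor that applies may
    witness it. [budget_full] accepts either order of [j] and [k] and so encodes the minimum;
    [budget_cone] demands both inequalities and so encodes the maximum. *)
Inductive budget (P : list point) (t s : point) (B : R) : Prop :=
| budget_arrived : s = t -> 0 <= B -> budget P t s B
| budget_cone i j k :
    perm3 i j k -> in_cone i s t ->
    (coord i t - coord i s) + (coord j s - coord j t) <= B ->
    (coord i t - coord i s) + (coord k s - coord k t) <= B -> budget P t s B
| budget_full i j k :
    perm3 i j k -> in_cone i t s ->
    2 * (coord i s - coord i t) + (coord j t - coord j s) <= B -> budget P t s B
| budget_side i j k :
    perm3 i j k -> in_cone i t s -> (forall x, In x P -> ~ side j s t x) ->
    (coord i s - coord i t) + (coord k t - coord k s) <= B -> budget P t s B.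

Lemma budget_nonneg P t s B : budget P t s B -> 0 <= B.
Proof.
  intros [_ L|i j k Hp Hc L _|i j k Hp Hc L|i j k Hp Hc _ L]; [assumption|..];
    destruct (proj1 (in_cone_coord _ _ _ _ _ Hp) Hc) as (_ & Lj & Lk);
    coord_facts Hp; lra.
Qed.

Lemma perm3_same_first i j k j' k' : perm3 i j k -> perm3 i j' k' ->
  (j' = j /\ k' = k \/ j' = k /\ k' = j)%nat.
Proof. unfold perm3; lia. Qed.

Lemma budget_in_cone P t s B i j k :
  distinct_coords P -> In s P -> In t P -> s <> t ->
  perm3 i j k -> in_cone i s t -> budget P t s B ->
  (coord i t - coord i s) + (coord j s - coord j t) <= B /\
  (coord i t - coord i s) + (coord k s - coord k t) <= B.
Proof.
  intros D Hs Ht N Hp Hc [E _|i' j' k' Hp' Hc' L1 L2|i' j' k' Hp' Hc' _|i' j' k' Hp' Hc' _ _].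
  - contradiction.
  - destruct (in_cone_unique P i i' s t D Hs Ht Hc Hc').
    destruct (perm3_same_first _ _ _ _ _ Hp Hp') as [[-> ->]|[-> ->]]; lra.
  - now destruct (in_cone_not_converse P i i' s t D Hs Ht Hc).
  - now destruct (in_cone_not_converse P i i' s t D Hs Ht Hc).
Qed.

Lemma budget_in_negative_cone P t s B i j k :
  distinct_coords P -> In s P -> In t P -> s <> t ->
  perm3 i j k -> in_cone i t s -> budget P t s B ->
  let G := coord i s - coord i t in
  let pj := coord j t - coord j s in
  let pk := coord k t - coord k s in
  2 * G + pj <= B \/ 2 * G + pk <= B \/
  (forall x, In x P -> ~ side j s t x) /\ G + pk <= B \/
  (forall x, In x P -> ~ side k s t x) /\ G + pj <= B.
Proof.
  intros D Hs Ht N Hp Hc [E _|i' j' k' Hp' Hc' _|i' j' k' Hp' Hc' L|i' j' k' Hp' Hc' Ej L];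
    cbv zeta.
  - contradiction.
  - now destruct (in_cone_not_converse P i i' t s D Ht Hs Hc).
  - destruct (in_cone_unique P i i' t s D Ht Hs Hc Hc').
    destruct (perm3_same_first _ _ _ _ _ Hp Hp') as [[-> ->]|[-> ->]]; auto.
  - destruct (in_cone_unique P i i' t s D Ht Hs Hc Hc').
    destruct (perm3_same_first _ _ _ _ _ Hp Hp') as [[-> ->]|[-> ->]]; auto.
Qed.

(* The edge overshoots [t] in coordinate [j], so [t] lies in the negative cone
   of [v]; one side region of [v] is inside the empty canonical triangle of [s]
   and [v], which is what makes [budget_side] available. *)
Lemma overshoot_budget P t s v B i j k :
  distinct_coords P -> In s P -> In t P -> s <> t ->
  perm3 i j k -> in_cone i s t -> closest P i s v -> v <> t ->
  coord j v < coord j t ->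
  (coord i t - coord i s) + (coord k s - coord k t) <= B ->
  budget P t v (B - edist s v).
Proof.
  intros D Hs Ht N Hp Hc Cl Nvt Lj L.
  pose proof (edist_in_cone i s v (proj1 (proj2 Cl))) as Le.
  apply closest_coord in Cl as (Hv & Cv & Min).
  pose proof (Min t Ht Hc) as Lt.
  destruct (in_cone_strict P i j k s t D Hp Hs Ht Hc) as [Tj Tk].
  destruct (in_cone_strict P i j k s v D Hp Hs Hv Cv) as [Vj Vk].
  pose proof (perm3_rot _ _ _ Hp) as Hp'; pose proof (perm3_rot _ _ _ Hp') as Hp''.
  coord_facts Hp.
  apply (budget_side _ _ _ _ k j i).
  - unfold perm3 in *; intuition.
  - rewrite (in_cone_coord _ _ _ _ _ Hp''); repeat split; try assumption; lra.
  - intros y Hy [Cy Ly].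
    destruct (in_cone_strict P j k i v y D Hp' Hv Hy Cy) as [Yk Yi].
    enough (coord i v <= coord i y) by lra.
    apply Min; [assumption|]; rewrite (in_cone_coord _ _ _ _ _ Hp); repeat split; try lra.
    intros ->; lra.
  - lra.
Qed.

(** An edge is no longer than the gain in the coordinate of its cone, and in every case the
    potential drops by at least this gain. *)
Lemma budget_step P t s v B :
  distinct_coords P -> In s P -> In t P -> s <> t ->
  edge P s v -> routing_step (edge P s) s t v ->
  budget P t s B -> budget P t v (B - edist s v).
Proof.
  intros D Hs Ht N Ev St Bs.
  assert (Hv : In v P) by apply Ev.
  destruct (classic (v = t)) as [->|Nvt].
  { apply budget_arrived; [reflexivity|].
    destruct (cone_or_converse P s t D Hs Ht N) as [i [Hc|Hc]];
      pose proof (edist_in_cone _ _ _ Hc) as Le;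
      destruct (perm3_extend i (proj1 Hc)) as (j & k & Hp).
    - destruct (in_cone_strict P i j k s t D Hp Hs Ht Hc) as [Tj Tk].
      pose proof (budget_in_cone P t s B i j k D Hs Ht N Hp Hc Bs); lra.
    - destruct (in_cone_strict P i j k t s D Hp Ht Hs Hc) as [Tj Tk].
      rewrite edist_sym.
      coord_facts Hp.
      destruct (budget_in_negative_cone P t s B i j k D Hs Ht N Hp Hc Bs)
        as [L|[L|[[_ L]|[_ L]]]]; lra. }
  (* Once [j] is treated as empty, [G + pk] is covered whatever was known before: [pj + pk = G], so
     [2 G + pj] and [2 G + pk] are at least as large; and if [k] was the empty side, no neighbour
     lies there, hence [pk <= pj]. *)
  assert (R : forall i j k, perm3 i j k -> in_cone i t s ->
    (forall x, edge P s x -> ~ side j s t x) ->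
    (exists x, edge P s x /\ side k s t x) \/
      coord k t - coord k s <= coord j t - coord j s ->
    coord i s - coord i t + (coord k t - coord k s) <= B).
  { intros i j k Hp Hc Ej Hk.
    destruct (in_cone_strict P i j k t s D Hp Ht Hs Hc) as [Tj Tk].
    coord_facts Hp.
    destruct (budget_in_negative_cone P t s B i j k D Hs Ht N Hp Hc Bs)
      as [L|[L|[[_ L]|[Ek L]]]]; try lra.
    destruct Hk as [(x & Ex & Sx)|Hk]; [|lra].
    destruct (Ek x); [apply Ex|assumption]. }
  destruct St as [i Hc Cv|i j k x Hp Hc Ex Sx Lp [Cv Lv]
    |i j k Hp Hc Ej Hk Min Mv|i j k Hp Hc Ej NM Sv].
  - destruct (perm3_extend i (proj1 Hc)) as (j & k & Hp).
    pose proof (edge_closest P i s v D Ev Cv) as Cl.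
    destruct (budget_in_cone P t s B i j k D Hs Ht N Hp Hc Bs) as [L1 L2].
    (* If [v] overshoots [t] in neither [j] nor [k], then [t] is still in [C_i] of [v]. *)
    destruct (Rlt_dec (coord j v) (coord j t)).
    { now apply (overshoot_budget P t s v B i j k). }
    destruct (Rlt_dec (coord k v) (coord k t)).
    { now apply (overshoot_budget P t s v B i k j); auto using perm3_swap. }
    pose proof (edist_in_cone _ _ _ Cv) as Le.
    destruct (in_cone_strict P i j k s v D Hp Hs Hv Cv) as [Vj Vk].
    apply (budget_cone _ _ _ _ i j k); [assumption| |lra..].
    rewrite (in_cone_coord _ _ _ _ _ Hp); repeat split; [congruence|lra..].
  - pose proof (perm3_rot _ _ _ Hp) as Hp'.
    destruct (in_cone_strict P i j k t s D Hp Ht Hs Hc) as [Tj Tk].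
    destruct (in_cone_strict P j k i s v D Hp' Hs Hv Cv) as [Vk Vi].
    pose proof (edist_in_cone _ _ _ Cv) as Le.
    apply (budget_full _ _ _ _ i j k); [assumption|..].
    + rewrite (in_cone_coord _ _ _ _ _ Hp); repeat split; [congruence|lra..].
    + destruct (budget_in_negative_cone P t s B i j k D Hs Ht N Hp Hc Bs)
        as [L|[L|[[E _]|[E _]]]]; try lra.
      * destruct (E v Hv); now split.
      * destruct (E x); [apply Ex|assumption].
  - pose proof (R i j k Hp Hc Ej Hk) as L.
    pose proof Mv as (Cv & Mj & Mk).
    destruct (in_cone_strict P i j k t s D Hp Ht Hs Hc) as [Tj Tk].
    destruct (in_cone_strict P i j k v s D Hp Hv Hs Cv) as [Vj Vk].
    pose proof (edist_in_cone _ _ _ Cv) as Le; rewrite edist_sym in Le.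
    apply (budget_side _ _ _ _ i j k); [assumption|..].
    + rewrite (in_cone_coord _ _ _ _ _ Hp); repeat split; [congruence|lra..].
    + apply (middle_step_empty P i j k s t D Hp Hs Ht Hc (side_empty P j s t Hs Ej) v);
        assumption.
    + lra.
  - pose proof (R i j k Hp Hc Ej (or_introl (ex_intro _ v (conj Ev Sv)))) as L.
    pose proof Sv as [Cv Lv].
    pose proof (perm3_rot _ _ _ (perm3_rot _ _ _ Hp)) as Hp'.
    destruct (in_cone_strict P i j k t s D Hp Ht Hs Hc) as [Tj Tk].
    destruct (in_cone_strict P k i j s v D Hp' Hs Hv Cv) as [Vi Vj].
    pose proof (edist_in_cone _ _ _ Cv) as Le.
    apply (budget_side _ _ _ _ i j k); [assumption|..].
    + rewrite (in_cone_coord _ _ _ _ _ Hp); repeat split; [congruence|lra..].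
    + apply (side_step_empty P i j k s t D Hp Hs Ht Hc (side_empty P j s t Hs Ej) v);
        assumption.
    + lra.
Qed.

(** * Termination and length of the route *)

Lemma min_distance (P : list point) :
  exists d, 0 < d /\ forall p q, In p P -> In q P -> p <> q -> d <= edist p q.
Proof.
  induction P as [|a P (d & Hd & IH)].
  { exists 1; split; [lra|intros p q []]. }
  assert (Ha : exists d', 0 < d' /\ forall q, In q P -> a <> q -> d' <= edist a q).
  { destruct (classic (exists x, In x P /\ a <> x)) as [Hx|Hx].
    - destruct (exists_argmin P (fun x => a <> x) (edist a) Hx) as (m & _ & Nm & Min).
      exists (edist a m); split; [now apply edist_pos|auto].
    - exists 1; split; [lra|]; intros q Hq N; exfalso; eauto. }
  destruct Ha as (d' & Hd' & Ha).
  exists (Rmin d d'); split; [now apply Rmin_glb_lt|].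
  pose proof (Rmin_l d d'); pose proof (Rmin_r d d').
  intros p q [<-|Hp] [<-|Hq] N.
  - contradiction.
  - specialize (Ha q Hq N); lra.
  - rewrite edist_sym.
    assert (N' : a <> p) by congruence.
    specialize (Ha p Hp N'); lra.
  - specialize (IH p q Hp Hq N); lra.
Qed.

Lemma route_pt_cons A P s t n :
  route_pt A P s t (S n) = route_pt A P (A P s t) t n.
Proof. exact (Nat.iter_succ_r n _ (fun x => A P x t) s). Qed.

Lemma route_len_cons A P s t n :
  route_len A P s t (S n) = edist s (A P s t) + route_len A P (A P s t) t n.
Proof.
  induction n as [|n IH].
  - simpl; lra.
  - change (route_len A P s t (S (S n))) with (route_len A P s t (S n) +
      edist (route_pt A P s t (S n)) (route_pt A P s t (S (S n)))).
    rewrite IH, (route_pt_cons _ _ _ _ n), (route_pt_cons _ _ _ _ (S n)).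
    cbn [route_len]; lra.
Qed.

Lemma routes_within_cons A P s t L :
  s <> t -> routes_within A P (A P s t) t (L - edist s (A P s t)) ->
  routes_within A P s t L.
Proof.
  intros N (n & [Arr Before] & Len).
  exists (S n); split; [split|].
  - now rewrite route_pt_cons.
  - intros [|j] Hj; [exact N|].
    rewrite route_pt_cons; apply Before; lia.
  - rewrite route_len_cons; lra.
Qed.

(** Each edge has length at least some [d > 0] and lowers the nonnegative budget by its length, so
    an [n] with [B < n d] bounds the number of steps and carries the induction. *)
Lemma theta_router_within P s t B :
  general_position P -> In s P -> In t P -> budget P t s B ->
  routes_within theta_router P s t B.
Proof.
  intros G Hs Ht Bs.
  pose proof (general_position_distinct P G) as D.
  destruct (min_distance P) as (d & Hd & Min).
  assert (Hn : exists n, B < INR n * d).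
  { destruct (INR_unbounded (B / d)) as [n Hn]; exists n.
    apply (Rmult_lt_compat_r d) in Hn; [|assumption].
    replace (B / d * d) with B in Hn by (field; lra); lra. }
  destruct Hn as [n Hn]; revert s B Hs Bs Hn.
  induction n as [|n IH]; intros s B Hs Bs Hn;
    pose proof (budget_nonneg _ _ _ _ Bs) as B0.
  { simpl in Hn; lra. }
  destruct (classic (s = t)) as [->|N].
  { exists 0%nat; split; [split; [reflexivity|lia]|assumption]. }
  destruct (theta_router_spec P s t D Hs Ht N) as [Ev St].
  set (v := theta_router P s t) in *.
  apply routes_within_cons; [assumption|].
  assert (Hv : In v P) by apply Ev.
  assert (Lv : d <= edist s v).
  { apply Min; try assumption; intros E; now apply (edge_neq _ _ _ Ev). }
  apply IH; [assumption|now apply budget_step|].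
  rewrite S_INR in Hn; fold v; lra.
Qed.

(** The projection of [uw] on the bisector is the height of the canonical triangle; the distance
    from [w] to the midpoint of the opposite side is half the difference of the pieces into which
    [w] divides that side. *)
Lemma cone_angle_sides i j k u w : perm3 i j k -> in_cone i u w ->
  edist u w * cos (cone_angle i u w) = sqrt 3 / 2 * (coord i w - coord i u) /\
  edist u w * sin (cone_angle i u w) = Rabs (coord j w - coord k w - (coord j u - coord k u)) / 2.
Proof.
  intros Hp Hc.
  destruct (proj1 (in_cone_coord _ _ _ _ _ Hp) Hc) as (N & Lj & Lk).
  assert (De : 0 < edist u w) by (apply edist_pos; congruence).
  pose proof (edist_coord i j k u w Hp) as Sq; cbv zeta in Sq.
  pose proof (proj_coord i u w) as Pr.
  pose proof sqrt3_pos; pose proof sqrt3_sq.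
  coord_facts Hp.
  unfold cone_angle.
  set (e := edist u w) in *; set (p := proj i u w) in *.
  set (a := coord j w - coord j u) in *; set (b := coord k w - coord k u) in *.
  replace (coord i w - coord i u) with (- a - b) in * by (unfold a, b; lra).
  replace (coord j w - coord k w - (coord j u - coord k u)) with (a - b) by (unfold a, b; lra).
  assert (Pp : p * p = 3 / 4 * ((a + b) * (a + b))) by (rewrite Pr; nra).
  assert (P0 : 0 <= p) by (rewrite Pr; unfold a, b; apply Rmult_le_pos; lra).
  assert (Hr : e * e - p * p = ((a - b) / 2) * ((a - b) / 2)) by (rewrite Sq, Pp; field).
  assert (Pe : p <= e).
  { apply Rsqr_incr_0_var; [unfold Rsqr|lra].
    pose proof (Rle_0_sqr ((a - b) / 2)); unfold Rsqr in *; lra. }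
  assert (Q : 0 <= p / e <= 1).
  { split; [apply Rmult_le_pos; [assumption|left; now apply Rinv_0_lt_compat]|].
    apply (Rmult_le_reg_r e); [assumption|].
    replace (p / e * e) with p by (field; lra); lra. }
  rewrite cos_acos, sin_acos by lra; split.
  - rewrite <- Pr; field; lra.
  - replace e with (sqrt (e * e)) by (apply sqrt_square; lra).
    rewrite sqrt_square at 2 by lra.
    rewrite <- sqrt_mult_alt by nra.
    replace (e * e * (1 - (p / e)²)) with (e * e - p * p)
      by (unfold Rsqr; field; lra).
    rewrite Hr; change ((a - b) / 2 * ((a - b) / 2)) with (Rsqr ((a - b) / 2)).
    rewrite sqrt_Rsqr_abs; unfold Rdiv; rewrite Rabs_mult, (Rabs_right (/ 2)); lra.
Qed.

(** With [G] the side and [p + q = G] its two pieces, the left-hand side is 3/2 G + |p - q| / 2. *)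
Lemma bound_to_sides i j k u w : perm3 i j k -> in_cone i u w ->
  bound_to (cone_angle i u w) * edist u w =
  (coord i w - coord i u) + Rmax (coord j u - coord j w) (coord k u - coord k w).
Proof.
  intros Hp Hc.
  destruct (cone_angle_sides i j k u w Hp Hc) as [Ec Es].
  coord_facts Hp; unfold bound_to.
  replace ((sqrt 3 * cos (cone_angle i u w) + sin (cone_angle i u w)) * edist u w)
    with (sqrt 3 * (edist u w * cos (cone_angle i u w)) + edist u w * sin (cone_angle i u w))
    by ring.
  rewrite Ec, Es.
  replace (sqrt 3 * (sqrt 3 / 2 * (coord i w - coord i u)))
    with (sqrt 3 * sqrt 3 / 2 * (coord i w - coord i u)) by field.
  rewrite sqrt3_sq.
  unfold Rabs, Rmax; destruct Rcase_abs, Rle_dec; lra.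
Qed.

(** With the same [G], [p], [q], the left-hand side is 5/2 G - |p - q| / 2. *)
Lemma bound_from_sides i j k u w : perm3 i j k -> in_cone i u w ->
  bound_from (cone_angle i u w) * edist u w =
  2 * (coord i w - coord i u) + Rmin (coord j u - coord j w) (coord k u - coord k w).
Proof.
  intros Hp Hc.
  destruct (cone_angle_sides i j k u w Hp Hc) as [Ec Es].
  pose proof sqrt3_pos.
  coord_facts Hp; unfold bound_from.
  replace ((5 / sqrt 3 * cos (cone_angle i u w) - sin (cone_angle i u w)) * edist u w)
    with (5 / sqrt 3 * (edist u w * cos (cone_angle i u w)) - edist u w * sin (cone_angle i u w))
    by ring.
  rewrite Ec, Es.
  replace (5 / sqrt 3 * (sqrt 3 / 2 * (coord i w - coord i u)))
    with (5 / 2 * (coord i w - coord i u)) by (field; lra).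
  unfold Rabs, Rmin; destruct Rcase_abs, Rle_dec; lra.
Qed.

Lemma theta_router_bounds P u w i :
  general_position P -> In u P -> In w P -> in_cone i u w ->
  routes_within theta_router P u w (bound_to (cone_angle i u w) * edist u w) /\
  routes_within theta_router P w u (bound_from (cone_angle i u w) * edist u w).
Proof.
  intros G Hu Hw Hc.
  destruct (perm3_extend i (proj1 Hc)) as (j & k & Hp).
  split; apply theta_router_within; try assumption.
  - rewrite (bound_to_sides i j k u w Hp Hc).
    set (p := coord j u - coord j w); set (q := coord k u - coord k w).
    pose proof (Rmax_l p q); pose proof (Rmax_r p q).
    apply (budget_cone _ _ _ _ i j k); auto; unfold p, q in *; lra.
  - rewrite (bound_from_sides i j k u w Hp Hc).
    (* At the start nothing is known about the side regions, so the budget is that of two occupied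
       sides. *)
    unfold Rmin; destruct Rle_dec.
    + apply (budget_full _ _ _ _ i j k); auto; lra.
    + apply (budget_full _ _ _ _ i k j); auto using perm3_swap; lra.
Qed.

(** * Lower bounds *)

Lemma route_len_ge A P s t n : edist s (route_pt A P s t n) <= route_len A P s t n.
Proof.
  induction n as [|n IH]; [simpl; rewrite edist_refl; lra|].
  cbn [route_len].
  pose proof (edist_triangle s (route_pt A P s t n) (route_pt A P s t (S n))); lra.
Qed.

Lemma route_pt_in A P s t n : valid_router A -> general_position P -> In s P -> In t P ->
  (forall j, (j < n)%nat -> route_pt A P s t j <> t) -> In (route_pt A P s t n) P.
Proof.
  intros V G Hs Ht; induction n as [|n IH]; intros H; [exact Hs|].
  apply (V P (route_pt A P s t n) t G); [|assumption|apply H; lia].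
  apply IH; intros j Hj; apply H; lia.
Qed.

Lemma detour_one_stop A P s t n : s <> t -> first_arrival A P s t n ->
  edist s (A P s t) + edist (A P s t) t <= route_len A P s t n.
Proof.
  intros N [Arr _]; destruct n as [|n]; [contradiction|].
  rewrite route_len_cons; rewrite route_pt_cons in Arr.
  pose proof (route_len_ge A P (A P s t) t n) as L; rewrite Arr in L; lra.
Qed.

(** Here [p] is the last vertex before [t]; whatever happens between the first stop and [p] is
    bounded below by the triangle inequality. *)
Lemma detour_two_stops A P s t n :
  valid_router A -> general_position P -> In s P -> In t P -> s <> t -> A P s t <> t ->
  first_arrival A P s t n ->
  exists p, edge P p t /\
    edist s (A P s t) + edist (A P s t) p + edist p t <= route_len A P s t n.
Proof.
  intros V G Hs Ht N N' [Arr Before].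
  destruct n as [|[|n]]; [contradiction|now destruct N'|].
  exists (route_pt A P s t (S n)); split.
  - assert (Hp : In (route_pt A P s t (S n)) P)
      by (apply route_pt_in; try assumption; intros j Hj; apply Before; lia).
    pose proof (V P _ t G Hp Ht (Before (S n) ltac:(lia))) as E.
    change (A P (route_pt A P s t (S n)) t) with (route_pt A P s t (S (S n))) in E.
    now rewrite Arr in E.
  - rewrite route_len_cons, route_pt_cons; cbn [route_len].
    rewrite route_pt_cons in Arr; rewrite Arr.
    pose proof (route_len_ge A P (A P s t) t n); lra.
Qed.

(** Scaling the height by [sqrt 3] makes all three coordinates linear in [x] and [t] with integer
    coefficients. *)
Definition pt (x t : R) : point := (x, sqrt 3 * t).

Lemma coord_0_pt x t : coord 0 (pt x t) = 2 * t.
Proof. rewrite coord_0; unfold pt; simpl; field; pose proof sqrt3_pos; lra. Qed.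

Lemma coord_1_pt x t : coord 1 (pt x t) = - x - t.
Proof. rewrite coord_1; unfold pt; simpl; field; pose proof sqrt3_pos; lra. Qed.

Lemma coord_2_pt x t : coord 2 (pt x t) = x - t.
Proof. rewrite coord_2; unfold pt; simpl; field; pose proof sqrt3_pos; lra. Qed.

Lemma pt_inj x t x' t' : pt x t = pt x' t' -> x = x' /\ t = t'.
Proof.
  unfold pt; intros E; injection E as Ex Et; split; [assumption|].
  apply (Rmult_eq_reg_l (sqrt 3)); [assumption|]; pose proof sqrt3_pos; lra.
Qed.

Lemma in_cone_0_pt x t x' t' :
  in_cone 0 (pt x t) (pt x' t') <->
  pt x' t' <> pt x t /\ - x' - t' <= - x - t /\ x' - t' <= x - t.
Proof.
  assert (H : perm3 0 1 2) by (unfold perm3; lia).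
  rewrite (in_cone_coord _ _ _ _ _ H), ?coord_0_pt, ?coord_1_pt, ?coord_2_pt.
  reflexivity.
Qed.

Lemma in_cone_1_pt x t x' t' :
  in_cone 1 (pt x t) (pt x' t') <->
  pt x' t' <> pt x t /\ x' - t' <= x - t /\ 2 * t' <= 2 * t.
Proof.
  assert (H : perm3 0 1 2) by (unfold perm3; lia).
  rewrite (in_cone_coord _ _ _ _ _ (perm3_rot _ _ _ H)), ?coord_0_pt, ?coord_1_pt, ?coord_2_pt.
  reflexivity.
Qed.

Lemma in_cone_2_pt x t x' t' :
  in_cone 2 (pt x t) (pt x' t') <->
  pt x' t' <> pt x t /\ 2 * t' <= 2 * t /\ - x' - t' <= - x - t.
Proof.
  assert (H : perm3 0 1 2) by (unfold perm3; lia).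
  rewrite (in_cone_coord _ _ _ _ _ (perm3_rot _ _ _ (perm3_rot _ _ _ H))).
  rewrite ?coord_0_pt, ?coord_1_pt, ?coord_2_pt.
  reflexivity.
Qed.

Lemma edist_pt x t x' t' :
  edist (pt x t) (pt x' t') * edist (pt x t) (pt x' t') =
  (x' - x) * (x' - x) + 3 * ((t' - t) * (t' - t)).
Proof.
  rewrite edist_xy; unfold pt; simpl.
  transitivity ((x' - x) * (x' - x) + sqrt 3 * sqrt 3 * ((t' - t) * (t' - t)));
    [ring|rewrite sqrt3_sq; ring].
Qed.

Lemma edist_pt_ge x t x' t' : Rabs (x' - x) <= edist (pt x t) (pt x' t').
Proof.
  pose proof (edist_nonneg (pt x t) (pt x' t')).
  rewrite <- (Rabs_right (edist _ _)) by lra.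
  apply Rsqr_le_abs_0; unfold Rsqr; rewrite edist_pt.
  pose proof (Rle_0_sqr (t' - t)); unfold Rsqr in *; lra.
Qed.

Lemma even_succ_negb j : Nat.even (S j) = negb (Nat.even j).
Proof. now rewrite Nat.even_succ, Nat.negb_even. Qed.

Lemma even_gap j j' : Nat.even j' = Nat.even j -> (j' < j)%nat -> (S (S j') <= j)%nat.
Proof.
  intros E L; destruct (Nat.eq_dec j (S j')) as [->|N]; [|lia].
  rewrite even_succ_negb in E; destruct (Nat.even j'); discriminate.
Qed.

(** * The zigzag point sets and their graphs *)

Section Zigzag.

(** In the scaled frame the top vertex is [(sx, tau)] and the upper corners of the triangle are
    [(-tau, tau)] and [(tau, tau)]. Points stand in the columns [-c] and [c], at depth [e j] below
    the top: [e_tau] keeps them in [C_0] of the bottom, [e_c] in [C_1] or [C_2] of the top. As [e]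
    is an infinite sequence, sets of different sizes share their first points. *)
Variables (c tau sx : R) (e : nat -> R).
Hypotheses (e_pos : forall j, 0 < e j) (e_lt : forall i j, (i < j)%nat -> e i < e j)
  (e_tau : forall j, e j < tau - c) (e_c : forall j, e j < c - sx)
  (sx_nonneg : 0 <= sx).

Definition bottom : point := pt 0 0.
Definition top : point := pt sx tau.
Definition column (b : bool) : R := if b then - c else c.
Definition zig (j : nat) : point := pt (column (Nat.even j)) (tau - e j).
Definition zigzag (n : nat) : list point := bottom :: top :: map zig (seq 0 n).

Lemma in_zigzag n x :
  In x (zigzag n) <-> x = bottom \/ x = top \/ exists j, (j < n)%nat /\ x = zig j.
Proof.
  unfold zigzag; simpl; rewrite in_map_iff; split.
  - intros [E|[E|(j & E & Hj)]]; auto.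
    apply in_seq in Hj; right; right; exists j; split; [lia|auto].
  - intros [E|[E|(j & Hj & E)]]; auto.
    right; right; exists j; rewrite in_seq; split; [auto|lia].
Qed.

Lemma e_inj i j : e i = e j -> i = j.
Proof.
  intros E; destruct (Nat.lt_trichotomy i j) as [L|[L|L]]; [|assumption|];
    apply e_lt in L; lra.
Qed.

Lemma e_le_inv i j : e i <= e j -> (i <= j)%nat.
Proof.
  intros E; destruct (Nat.le_gt_cases i j) as [L|L]; [assumption|].
  apply e_lt in L; lra.
Qed.

Lemma e_le i j : (i <= j)%nat -> e i <= e j.
Proof.
  intros L; destruct (Nat.eq_dec i j) as [->|N]; [lra|].
  left; apply e_lt; lia.
Qed.

Lemma zig_inj i j : zig i = zig j -> i = j.
Proof. intros E; apply pt_inj in E as [_ E]; apply e_inj; lra. Qed.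

Ltac e_facts :=
  repeat match goal with
  | j : nat |- _ =>
    lazymatch goal with
    | _ : 0 < e j |- _ => fail
    | _ => pose proof (e_pos j); pose proof (e_tau j); pose proof (e_c j)
    end
  end; pose proof (e_pos 0); pose proof (e_tau 0); pose proof (e_c 0).

Lemma zig_neq_bottom j : zig j <> bottom.
Proof. intros E; apply pt_inj in E as [_ E]; e_facts; lra. Qed.

Lemma zig_neq_top j : zig j <> top.
Proof. intros E; apply pt_inj in E as [_ E]; e_facts; lra. Qed.

Lemma top_neq_bottom : top <> bottom.
Proof. intros E; apply pt_inj in E as [_ E]; e_facts; lra. Qed.

Lemma zigzag_general_position n : general_position (zigzag n).
Proof.
  apply general_position_coord; intros p q Hp Hq N i Hi.
  apply in_zigzag in Hp, Hq.
  destruct Hp as [->|[->|(j & Hj & ->)]], Hq as [->|[->|(j' & Hj' & ->)]];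
    try contradiction;
    try (assert (Ne : e j <> e j') by (intros E; apply e_inj in E; congruence));
    unfold bottom, top, zig; e_facts;
    destruct i as [|[|[|i]]]; try lia;
    rewrite ?coord_0_pt, ?coord_1_pt, ?coord_2_pt; unfold column;
    repeat match goal with
    | |- context [Nat.even ?m] => destruct (Nat.even m)
    end;
    intros E; lra.
Qed.

(** The edges directed out of positive cones, except the one at [bottom]. The number of points does
    not occur, which is why the graph near the top cannot reveal it. *)
Inductive out : point -> point -> Prop :=
| out_top_left : out top (zig 0)
| out_top_right : out top (zig 1)
| out_up j : out (zig (S (S j))) (zig j)
| out_down j : out (zig j) (zig (S j)).

Ltac cone_cases i :=
  let Hi := fresh in
  intros Hi; pose proof (proj1 Hi);
  destruct i as [|[|[|i]]]; [| | |lia].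

Ltac unfold_cones :=
  unfold bottom, top, zig in *;
  rewrite ?in_cone_0_pt, ?in_cone_1_pt, ?in_cone_2_pt, ?coord_0_pt, ?coord_1_pt, ?coord_2_pt in *.

Lemma cone_bottom i n x : in_cone i bottom x -> In x (zigzag n) -> i = 0%nat.
Proof.
  cone_cases i; intros Hx; [reflexivity|exfalso..]; apply in_zigzag in Hx;
    destruct Hx as [->|[->|(j & _ & ->)]]; unfold_cones; unfold column in *; e_facts;
    try (destruct (Nat.even j)); intuition lra.
Qed.

Lemma cone_top i n x : in_cone i top x -> In x (zigzag n) ->
  exists j, x = zig j /\ (i = 1%nat /\ Nat.even j = true \/ i = 2%nat /\ Nat.even j = false).
Proof.
  cone_cases i; intros Hx; apply in_zigzag in Hx;
    destruct Hx as [->|[->|(j & _ & ->)]]; unfold_cones; unfold column in *; e_facts;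
    try solve [exfalso; try (destruct (Nat.even j)); intuition lra].
  - exists j; split; [reflexivity|]; destruct (Nat.even j); [auto|exfalso; intuition lra].
  - exists j; split; [reflexivity|]; destruct (Nat.even j); [exfalso; intuition lra|auto].
Qed.

Lemma cone_zig i j n x : in_cone i (zig j) x -> In x (zigzag n) ->
  exists j', x = zig j' /\
    (i = 0%nat /\ Nat.even j' = Nat.even j /\ (j' < j)%nat \/
     i = 1%nat /\ Nat.even j = false /\ Nat.even j' = true /\ (j < j')%nat \/
     i = 2%nat /\ Nat.even j = true /\ Nat.even j' = false /\ (j < j')%nat).
Proof.
  intros Hc Hx; apply in_zigzag in Hx.
  assert (L : (i < 3)%nat) by apply Hc.
  assert (N : x <> zig j) by apply Hc.
  destruct Hx as [->|[->|(j' & _ & ->)]].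
  - exfalso; destruct i as [|[|[|i]]]; [| | |lia]; unfold_cones; unfold column in *; e_facts;
      destruct (Nat.even j); intuition lra.
  - exfalso; destruct i as [|[|[|i]]]; [| | |lia]; unfold_cones; unfold column in *; e_facts;
      destruct (Nat.even j); intuition lra.
  - exists j'; split; [reflexivity|].
    assert (Nj : j' <> j) by congruence.
    destruct i as [|[|[|i]]]; [| | |lia]; unfold_cones; destruct Hc as (_ & H1 & H2);
      unfold column in *; e_facts.
    + left; split; [reflexivity|].
      destruct (Nat.even j), (Nat.even j'); try (exfalso; lra);
        (split; [reflexivity|]); enough (j' <= j)%nat by lia; apply e_le_inv; lra.
    + right; left; split; [reflexivity|].
      assert (j <= j')%nat by (apply e_le_inv; lra).
      destruct (Nat.even j), (Nat.even j'); try (exfalso; lra); repeat split; try lia;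
        exfalso; apply Nj, e_inj; lra.
    + right; right; split; [reflexivity|].
      assert (j <= j')%nat by (apply e_le_inv; lra).
      destruct (Nat.even j), (Nat.even j'); try (exfalso; lra); repeat split; try lia;
        exfalso; apply Nj, e_inj; lra.
Qed.

Lemma zig_in_cone_0 j j' :
  Nat.even j' = Nat.even j -> (j' < j)%nat -> in_cone 0 (zig j) (zig j').
Proof.
  intros E L; pose proof (e_lt _ _ L).
  assert (N : zig j' <> zig j) by (intros Z; apply zig_inj in Z; lia).
  unfold_cones; rewrite E in *; split; [assumption|lra].
Qed.

Lemma zig_in_cone_1 j j' :
  Nat.even j = false -> Nat.even j' = true -> (j < j')%nat -> in_cone 1 (zig j) (zig j').
Proof.
  intros E E' L; pose proof (e_lt _ _ L).
  assert (N : zig j' <> zig j) by (intros Z; apply zig_inj in Z; lia).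
  unfold_cones; rewrite E, E' in *; unfold column in *; e_facts; split; [assumption|lra].
Qed.

Lemma zig_in_cone_2 j j' :
  Nat.even j = true -> Nat.even j' = false -> (j < j')%nat -> in_cone 2 (zig j) (zig j').
Proof.
  intros E E' L; pose proof (e_lt _ _ L).
  assert (N : zig j' <> zig j) by (intros Z; apply zig_inj in Z; lia).
  unfold_cones; rewrite E, E' in *; unfold column in *; e_facts; split; [assumption|lra].
Qed.

Lemma zig_in_cone_top_1 j : Nat.even j = true -> in_cone 1 top (zig j).
Proof.
  intros E; pose proof (zig_neq_top j).
  unfold_cones; rewrite E in *; unfold column in *; e_facts; split; [assumption|lra].
Qed.

Lemma zig_in_cone_top_2 j : Nat.even j = false -> in_cone 2 top (zig j).
Proof.
  intros E; pose proof (zig_neq_top j).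
  unfold_cones; rewrite E in *; unfold column in *; e_facts; split; [assumption|lra].
Qed.

Lemma zig_in_cone_bottom j : in_cone 0 bottom (zig j).
Proof.
  pose proof (zig_neq_bottom j).
  unfold_cones; unfold column in *; e_facts; split; [assumption|].
  destruct (Nat.even j); lra.
Qed.

Lemma zig_coord_0_le j j' : coord 0 (zig j) <= coord 0 (zig j') <-> (j' <= j)%nat.
Proof.
  unfold_cones; split; intros H; [apply e_le_inv|apply e_le in H]; lra.
Qed.

Lemma zig_coord_1_le j j' : Nat.even j = Nat.even j' ->
  coord 1 (zig j) <= coord 1 (zig j') <-> (j <= j')%nat.
Proof.
  intros E; unfold_cones; rewrite E; split; intros H; [apply e_le_inv|apply e_le in H]; lra.
Qed.

Lemma zig_coord_2_le j j' : Nat.even j = Nat.even j' ->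
  coord 2 (zig j) <= coord 2 (zig j') <-> (j <= j')%nat.
Proof.
  intros E; unfold_cones; rewrite E; split; intros H; [apply e_le_inv|apply e_le in H]; lra.
Qed.

Lemma zig_in n j : (j < n)%nat -> In (zig j) (zigzag n).
Proof. intros L; apply in_zigzag; eauto. Qed.

Lemma out_closest n x y : In x (zigzag n) -> In y (zigzag n) -> out x y ->
  exists i, closest (zigzag n) i x y.
Proof.
  intros Hx Hy O; destruct O as [| |j|j].
  - exists 1%nat; apply closest_coord; repeat split; [assumption|lia| | |].
    + apply zig_neq_top.
    + now apply zig_in_cone_top_1.
    + intros x Ix Cx; destruct (cone_top _ _ _ Cx Ix) as (j & -> & [[_ E]|[? _]]); [|lia].
      apply zig_coord_1_le; [now rewrite E|lia].
  - exists 2%nat; apply closest_coord; repeat split; [assumption|lia| | |].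
    + apply zig_neq_top.
    + now apply zig_in_cone_top_2.
    + intros x Ix Cx; destruct (cone_top _ _ _ Cx Ix) as (j & -> & [[? _]|[_ E]]); [lia|].
      apply zig_coord_2_le; [now rewrite E|destruct j; [discriminate|lia]].
  - exists 0%nat; apply closest_coord; split; [assumption|split].
    + apply zig_in_cone_0; [reflexivity|lia].
    + intros x Ix Cx.
      destruct (cone_zig _ _ _ _ Cx Ix) as (j' & -> & [(_ & E & L)|[[? _]|[? _]]]); [|lia..].
      apply zig_coord_0_le; apply even_gap in L; [lia|assumption].
  - assert (En := even_succ_negb j).
    exists (if Nat.even j then 2 else 1)%nat; apply closest_coord; split; [assumption|split].
    + destruct (Nat.even j) eqn:Ej; [apply zig_in_cone_2|apply zig_in_cone_1]; auto.
    + intros x Ix Cx.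
      destruct (cone_zig _ _ _ _ Cx Ix)
        as (j' & -> & [(E0 & _)|[(E1 & E & E' & L)|(E1 & E & E' & L)]]);
        [destruct (Nat.even j); discriminate|..]; rewrite E in En |- *.
      * apply zig_coord_1_le; [now rewrite En, E'|lia].
      * apply zig_coord_2_le; [now rewrite En, E'|lia].
Qed.

(** All other points are in [C_0] of the bottom, and the last one is the lowest because [e]
    increases. *)
Lemma closest_bottom n i y : closest (zigzag (S n)) i bottom y -> y = zig n.
Proof.
  intros Cl; apply closest_coord in Cl as (Hy & Cy & Min).
  rewrite (cone_bottom i (S n) y Cy Hy) in *.
  pose proof (Min (zig n) (zig_in (S n) n (Nat.lt_succ_diag_r n)) (zig_in_cone_bottom n)) as L.
  apply in_zigzag in Hy as [->|[->|(j & Hj & ->)]].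
  - now destruct Cy as (_ & N & _).
  - unfold_cones; e_facts; lra.
  - apply zig_coord_0_le in L; f_equal; lia.
Qed.

(** In [C_1] and [C_2] the closest point has the smallest admissible index, in [C_0] the largest;
    comparison with that candidate pins down [y]. *)
Lemma closest_out n i x y : x <> bottom -> In x (zigzag n) ->
  closest (zigzag n) i x y -> out x y.
Proof.
  intros Nx Hx Cl; apply closest_coord in Cl as (Hy & Cy & Min).
  pose proof (proj1 (in_zigzag n y) Hy) as Iy.
  apply in_zigzag in Hx as [->|[->|(j & Hj & ->)]]; [contradiction|..].
  - destruct (cone_top _ _ _ Cy Hy) as (j' & -> & [[-> E]|[-> E]]);
      destruct Iy as [Z|[Z|(j & Hj & Z)]];
      try (now apply zig_neq_bottom in Z); try (now apply zig_neq_top in Z);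
      apply zig_inj in Z; subst j.
    + assert (L : coord 1 (zig j') <= coord 1 (zig 0)).
      { apply Min; [apply zig_in; lia|now apply zig_in_cone_top_1]. }
      apply zig_coord_1_le in L; [|assumption].
      replace j' with 0%nat by lia; constructor.
    + assert (1 <= j')%nat by (destruct j'; [discriminate|lia]).
      assert (L : coord 2 (zig j') <= coord 2 (zig 1)).
      { apply Min; [apply zig_in; lia|now apply zig_in_cone_top_2]. }
      apply zig_coord_2_le in L; [|assumption].
      replace j' with 1%nat by lia; constructor.
  - destruct (cone_zig _ _ _ _ Cy Hy) as
      (j' & -> & [(-> & E & L)|[(-> & E & E' & L)|(-> & E & E' & L)]]);
      destruct Iy as [Z|[Z|(j'' & Hj' & Z)]];
      try (now apply zig_neq_bottom in Z); try (now apply zig_neq_top in Z);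
      apply zig_inj in Z; subst j''.
    + apply even_gap in L; [|assumption].
      destruct j as [|[|j]]; [lia..|].
      assert (M : coord 0 (zig j') <= coord 0 (zig j)).
      { apply Min; [apply zig_in; lia|apply zig_in_cone_0; [reflexivity|lia]]. }
      apply zig_coord_0_le in M; replace j' with j by lia; constructor.
    + pose proof (even_succ_negb j) as En; rewrite E in En.
      assert (M : coord 1 (zig j') <= coord 1 (zig (S j))).
      { apply Min; [apply zig_in; lia|apply zig_in_cone_1; auto]. }
      apply zig_coord_1_le in M; [|now rewrite E'].
      replace j' with (S j) by lia; constructor.
    + pose proof (even_succ_negb j) as En; rewrite E in En.
      assert (M : coord 2 (zig j') <= coord 2 (zig (S j))).
      { apply Min; [apply zig_in; lia|apply zig_in_cone_2; auto]. }
      apply zig_coord_2_le in M; [|now rewrite E'].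
      replace j' with (S j) by lia; constructor.
Qed.

Lemma edge_cases n x y : edge (zigzag (S n)) x y ->
  out x y \/ out y x \/ x = bottom /\ y = zig n \/ y = bottom /\ x = zig n.
Proof.
  intros (Hx & Hy & i & _ & [Cl|Cl]).
  - destruct (classic (x = bottom)) as [->|N]; [apply closest_bottom in Cl; auto|].
    apply closest_out in Cl; auto.
  - destruct (classic (y = bottom)) as [->|N]; [apply closest_bottom in Cl; auto|].
    apply closest_out in Cl; auto.
Qed.

Lemma out_shape x y : out x y ->
  (exists j, y = zig j) /\
  (x = top /\ (y = zig 0 \/ y = zig 1) \/ exists j, x = zig j).
Proof. intros []; eauto 6. Qed.

Lemma edge_bottom n x : edge (zigzag (S n)) x bottom -> x = zig n.
Proof.
  intros E; apply edge_cases in E as [O|[O|[[-> E]|[_ E]]]]; [..|assumption];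
    try apply out_shape in O as [[j Ej] [[Et _]|[j' Ej']]].
  - symmetry in Ej; now apply zig_neq_bottom in Ej.
  - symmetry in Ej; now apply zig_neq_bottom in Ej.
  - symmetry in Et; now apply top_neq_bottom in Et.
  - symmetry in Ej'; now apply zig_neq_bottom in Ej'.
  - symmetry in E; now apply zig_neq_bottom in E.
Qed.

Lemma edge_top n x : edge (zigzag (S n)) top x -> x = zig 0 \/ x = zig 1.
Proof.
  intros E; apply edge_cases in E as [O|[O|[[E _]|[_ E]]]];
    try apply out_shape in O as [[j Ej] [[Et H]|[j' Ej']]].
  - assumption.
  - symmetry in Ej'; now apply zig_neq_top in Ej'.
  - symmetry in Ej; now apply zig_neq_top in Ej.
  - symmetry in Ej; now apply zig_neq_top in Ej.
  - now apply top_neq_bottom in E.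
  - symmetry in E; now apply zig_neq_top in E.
Qed.

Definition near_top (m : nat) (x : point) : Prop :=
  x = top \/ exists j, (j < m)%nat /\ x = zig j.

Lemma near_top_in m n x : (m <= n)%nat -> near_top m x -> In x (zigzag n).
Proof.
  intros L [->|(j & Hj & ->)]; apply in_zigzag; [auto|].
  right; right; exists j; split; [lia|reflexivity].
Qed.

Lemma near_top_out m x y : near_top m x -> out x y \/ out y x -> near_top (S (S m)) y.
Proof.
  intros Hx HO.
  assert (Z : forall j, (j < S (S m))%nat -> near_top (S (S m)) (zig j)) by (right; eauto).
  destruct HO as [O|O]; destruct O as [| |j|j]; try (apply Z; lia); try (now left);
    destruct Hx as [E|(j' & Hj & E)]; try (now apply zig_neq_top in E);
    apply zig_inj in E; apply Z; lia.
Qed.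

Lemma near_top_edge m n n' x y :
  (S (S m) <= S n)%nat -> (S (S m) <= S n')%nat -> near_top m x ->
  edge (zigzag (S n)) x y -> edge (zigzag (S n')) x y /\ near_top (S (S m)) y.
Proof.
  intros L L' Hx E.
  assert (Ix := near_top_in m (S n') x ltac:(lia) Hx).
  assert (O : out x y \/ out y x).
  { apply edge_cases in E as [O|[O|[[-> _]|[_ E]]]]; auto; exfalso;
      destruct Hx as [Z|(j & Hj & Z)].
    - now apply (top_neq_bottom).
    - symmetry in Z; now apply zig_neq_bottom in Z.
    - rewrite Z in E; symmetry in E; now apply zig_neq_top in E.
    - rewrite Z in E; apply zig_inj in E; lia. }
  pose proof (near_top_out m x y Hx O) as Hy.
  split; [|assumption].
  assert (Iy := near_top_in _ (S n') y L' Hy).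
  destruct O as [O|O].
  - destruct (out_closest (S n') x y Ix Iy O) as [i Cl].
    now apply (closest_edge _ i).
  - destruct (out_closest (S n') y x Iy Ix O) as [i Cl].
    now apply edge_sym, (closest_edge _ i).
Qed.

(** An edge raises the index by at most 2, so [k] edges from the top stay among the first [2 * k]
    points. These exclude the last point, the only neighbour of the bottom, and the edges met are
    the same in both sets. *)
Lemma reach_top k n n' x : (2 * k <= n)%nat -> (2 * k <= n')%nat ->
  reach (zigzag (S n)) k top x -> reach (zigzag (S n')) k top x /\ near_top (2 * k) x.
Proof.
  revert x; induction k as [|k IH]; intros x L L'.
  - intros [-> _]; split; [split; [reflexivity|apply in_zigzag; auto]|now left].
  - assert (W : forall x, near_top (2 * k) x -> near_top (2 * S k) x).
    { intros z [->|(j & Hj & ->)]; [now left|right; exists j; split; [lia|reflexivity]]. }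
    intros [H|(y & H & E)]; apply IH in H as [H Hn]; try lia.
    + split; [now left|auto].
    + destruct (near_top_edge (2 * k) n n' y x ltac:(lia) ltac:(lia) Hn E) as [E' Hn'].
      split; [right; eauto|].
      now replace (2 * S k)%nat with (S (S (2 * k))) by lia.
Qed.

(** The scaled height exceeds [c], so the squared distance is at least c^2 + 3 c^2. *)
Lemma zig_bottom_dist j : 2 * c <= edist (zig j) bottom.
Proof.
  pose proof (edist_nonneg (zig j) bottom); e_facts.
  apply Rsqr_incr_0_var; [unfold Rsqr|assumption].
  unfold zig, bottom; rewrite edist_pt.
  assert (c * c <= (0 - (tau - e j)) * (0 - (tau - e j))) by nra.
  unfold column; destruct (Nat.even j); lra.
Qed.

Lemma zig_top_dist j :
  (if Nat.even j then c + sx else c - sx) <= edist top (zig j).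
Proof.
  pose proof (edist_pt_ge sx tau (column (Nat.even j)) (tau - e j)) as H.
  change (pt sx tau) with top in H; change (pt (column (Nat.even j)) (tau - e j)) with (zig j) in H.
  unfold column in H; destruct (Nat.even j);
    [pose proof (Rle_abs (- (- c - sx))) as L; rewrite Rabs_Ropp in L|
     pose proof (Rle_abs (c - sx)) as L]; lra.
Qed.

Lemma zig_across_dist i j : Nat.even i = negb (Nat.even j) -> 2 * c <= edist (zig i) (zig j).
Proof.
  intros E.
  pose proof (edist_pt_ge (column (Nat.even i)) (tau - e i) (column (Nat.even j)) (tau - e j)) as H.
  change (pt (column (Nat.even i)) (tau - e i)) with (zig i) in H.
  change (pt (column (Nat.even j)) (tau - e j)) with (zig j) in H.
  rewrite E in H; unfold column in H; destruct (Nat.even j); simpl in H;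
    [pose proof (Rle_abs (- (- c - c))) as L; rewrite Rabs_Ropp in L|
     pose proof (Rle_abs (c - - c)) as L]; lra.
Qed.

Lemma upward_route_ge A n : valid_router A ->
  first_arrival A (zigzag 1) bottom top n ->
  3 * c + sx <= route_len A (zigzag 1) bottom top n.
Proof.
  intros V F.
  assert (Nt : bottom <> top) by (intros E; symmetry in E; now apply top_neq_bottom in E).
  pose proof (detour_one_stop _ _ _ _ _ Nt F) as L.
  assert (E : edge (zigzag 1) bottom (A (zigzag 1) bottom top)).
  { apply V; [apply zigzag_general_position| | |assumption]; apply in_zigzag; auto. }
  apply edge_sym, edge_bottom in E; rewrite E in L.
  rewrite (edist_sym bottom), (edist_sym _ top) in L.
  pose proof (zig_bottom_dist 0); pose proof (zig_top_dist 0) as T; simpl in T; lra.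
Qed.

(** The legs to the first point, across to the last one, and down to the bottom have lengths at
    least c - sx, 2 c and 2 c. *)
Lemma downward_route_ge A m j n : valid_router A ->
  A (zigzag (S m)) top bottom = zig j -> Nat.even j = negb (Nat.even m) ->
  first_arrival A (zigzag (S m)) top bottom n ->
  5 * c - sx <= route_len A (zigzag (S m)) top bottom n.
Proof.
  intros V E Hj F.
  destruct (detour_two_stops A (zigzag (S m)) top bottom n) as (p & Ep & L);
    try assumption; try (apply in_zigzag; auto).
  - apply zigzag_general_position.
  - apply top_neq_bottom.
  - rewrite E; apply zig_neq_bottom.
  - apply edge_bottom in Ep; subst p; rewrite E in L.
    pose proof (zig_bottom_dist m); pose proof (zig_across_dist j m Hj).
    pose proof (zig_top_dist j) as T.
    destruct (Nat.even j); lra.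
Qed.

(** One more point switches the side of the bottom's neighbour but leaves the first step from the
    top unchanged, so in one of the two sets this step goes to the wrong side. *)
Lemma downward_zigzag A k : valid_router A -> k_local k A ->
  exists m, forall n, first_arrival A (zigzag (S m)) top bottom n ->
    5 * c - sx <= route_len A (zigzag (S m)) top bottom n.
Proof.
  intros V Loc; set (m := (2 * k)%nat).
  assert (In_bt : forall n, In top (zigzag n) /\ In bottom (zigzag n))
    by (intros n; rewrite !in_zigzag; auto).
  assert (E : A (zigzag (S m)) top bottom = A (zigzag (S (S m))) top bottom).
  { apply Loc; try apply In_bt; try apply zigzag_general_position.
    intros x; split; intros R; eapply reach_top; try exact R; unfold m; lia. }
  assert (Em : Nat.even m = true) by apply Nat.even_mul.
  assert (St : edge (zigzag (S m)) top (A (zigzag (S m)) top bottom)).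
  { apply V; try apply In_bt; [apply zigzag_general_position|apply top_neq_bottom]. }
  (* Even indices are on the left: after a step to [zig 0] the last index should be odd, hence
     [S m]; after a step to [zig 1] it should be even, hence [m]. *)
  apply edge_top in St as [Z|Z].
  - exists (S m); intros n; apply (downward_route_ge A (S m) 0); [assumption|congruence|].
    now rewrite even_succ_negb, Em.
  - exists m; intros n; apply (downward_route_ge A m 1); [assumption..|].
    now rewrite Em.
Qed.

End Zigzag.

(** * Parameters for a given angle and error *)

Lemma zigzag_gaps eps : 0 < eps -> exists e : nat -> R,
  (forall j, 0 < e j) /\ (forall i j, (i < j)%nat -> e i < e j) /\ (forall j, e j < eps).
Proof.
  intros He; exists (fun j => eps * (1 - / INR (j + 2))).
  assert (H : forall j, 1 < INR (j + 2)).
  { intros j; rewrite plus_INR; simpl; pose proof (pos_INR j); lra. }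
  assert (I : forall j, 0 < / INR (j + 2) < 1).
  { intros j; specialize (H j); split; [apply Rinv_0_lt_compat; lra|].
    rewrite <- Rinv_1; apply Rinv_lt_contravar; lra. }
  repeat split.
  - intros j; specialize (I j); apply Rmult_lt_0_compat; lra.
  - intros i j L; apply Rmult_lt_compat_l; [assumption|].
    assert (/ INR (j + 2) < / INR (i + 2)); [|lra].
    apply Rinv_lt_contravar; [pose proof (H i); pose proof (H j); nra|].
    apply lt_INR; lia.
  - intros j; specialize (I j).
    rewrite <- (Rmult_1_r eps) at 2; apply Rmult_lt_compat_l; lra.
Qed.

(** The point [w] is the unit vector tilted by [a] from the bisector. As sin (pi/6 - a) > 0, it is
    strictly inside the cone, which leaves room for a column between it and the corner. *)
Lemma angle_geometry a : 0 <= a < PI / 6 ->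
  let u := pt 0 0 in let w := pt (sin a) (cos a / sqrt 3) in
  0 <= sin a < cos a / sqrt 3 /\ edist u w = 1 /\ in_cone 0 u w /\ cone_angle 0 u w = a.
Proof.
  intros [A0 A6] u w; pose proof PI_RGT_0; pose proof sqrt3_pos; pose proof sqrt3_sq.
  assert (S0 : 0 <= sin a) by (apply sin_ge_0; lra).
  assert (St : 0 < sin (PI / 6 - a)) by (apply sin_gt_0; lra).
  rewrite sin_minus, sin_PI6, cos_PI6 in St.
  assert (Lt : sin a < cos a / sqrt 3).
  { apply (Rmult_lt_reg_r (sqrt 3)); [assumption|].
    replace (cos a / sqrt 3 * sqrt 3) with (cos a) by (field; lra); lra. }
  assert (D : edist u w = 1).
  { apply Rsqr_inj; [apply edist_nonneg|lra|]; unfold Rsqr, u, w; rewrite edist_xy.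
    unfold pt; simpl.
    replace (sqrt 3 * (cos a / sqrt 3)) with (cos a) by (field; lra).
    pose proof (sin2_cos2 a); unfold Rsqr in *; lra. }
  repeat split; try assumption.
  - lia.
  - intros E; rewrite E, edist_refl in D; lra.
  - change (dot (vsub w u) (bisector 0)) with (proj 0 u w).
    change (norm (vsub w u)) with (edist u w).
    rewrite D, proj_coord; unfold u, w; rewrite !coord_0_pt.
    replace (sqrt 3 / 2 * (2 * (cos a / sqrt 3) - 2 * 0)) with (cos a) by (field; lra).
    pose proof (cos_decr_1 a (PI / 6)); lra.
  - unfold cone_angle; rewrite D, proj_coord; unfold u, w; rewrite !coord_0_pt.
    replace (sqrt 3 / 2 * (2 * (cos a / sqrt 3) - 2 * 0) / 1) with (cos a) by (field; lra).
    apply acos_cos; lra.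
Qed.

Theorem theorem2 :
  (exists A : router, valid_router A /\ k_local 1 A /\
     forall (P : list point) (u w : point) (i : nat),
       general_position P -> In u P -> In w P -> in_cone i u w ->
       routes_within A P u w (bound_to (cone_angle i u w) * edist u w) /\
       routes_within A P w u (bound_from (cone_angle i u w) * edist u w))
  /\
  (forall (k : nat) (A : router), valid_router A -> k_local k A ->
     forall (a eps : R), 0 <= a < PI / 6 -> 0 < eps ->
       (exists (P : list point) (u w : point) (i : nat),
          general_position P /\ In u P /\ In w P /\ in_cone i u w /\
          cone_angle i u w = a /\
          forall n, first_arrival A P u w n ->
            route_len A P u w n >= (bound_to a - eps) * edist u w)
       /\
       (exists (P : list point) (u w : point) (i : nat),
          general_position P /\ In u P /\ In w P /\ in_cone i u w /\
          cone_angle i u w = a /\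
          forall n, first_arrival A P w u n ->
            route_len A P w u n >= (bound_from a - eps) * edist u w)).
Proof.
  split.
  { exists theta_router; split; [exact theta_router_valid|].
    split; [exact theta_router_local|exact theta_router_bounds]. }
  intros k A V Loc a eps Ha He.
  destruct (angle_geometry a Ha) as ([S0 St] & D & Hc & Ang).
  set (sx := sin a) in *; set (tau := cos a / sqrt 3) in *.
  (* The first term gives [eta <= c - sx], hence [e_c]; the second absorbs the loss from replacing
     [tau] by [c], which is [3 * eta] upward and [5 * eta] downward. *)
  set (eta := Rmin ((tau - sx) / 2) (eps / 5)).
  assert (E0 : 0 < eta) by (apply Rmin_glb_lt; lra).
  assert (E1 : eta <= (tau - sx) / 2) by apply Rmin_l.
  assert (E2 : eta <= eps / 5) by apply Rmin_r.
  set (c := tau - eta).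
  destruct (zigzag_gaps eta E0) as (e & e_pos & e_lt & e_eta).
  assert (e_tau : forall j, e j < tau - c) by (intros j; specialize (e_eta j); unfold c; lra).
  assert (e_c : forall j, e j < c - sx) by (intros j; specialize (e_eta j); unfold c; lra).
  assert (T3 : sqrt 3 * cos a = 3 * tau).
  { unfold tau; rewrite <- sqrt3_sq at 2; field; pose proof sqrt3_pos; lra. }
  assert (T5 : 5 / sqrt 3 * cos a = 5 * tau).
  { unfold tau; field; pose proof sqrt3_pos; lra. }
  change (pt 0 0) with bottom in *; change (pt sx tau) with (top tau sx) in *.
  assert (I : forall n, general_position (zigzag c tau sx e n) /\
    In bottom (zigzag c tau sx e n) /\ In (top tau sx) (zigzag c tau sx e n)).
  { intros n; split; [now apply zigzag_general_position|].
    rewrite !in_zigzag; auto. }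
  split.
  - exists (zigzag c tau sx e 1), bottom, (top tau sx), 0%nat.
    destruct (I 1%nat) as (G & Hu & Hw); repeat (split; [assumption|]).
    intros n F; rewrite D; unfold bound_to; rewrite T3; fold sx.
    pose proof (upward_route_ge c tau sx e e_pos e_lt e_tau e_c S0 A n V F).
    unfold c in *; lra.
  - destruct (downward_zigzag c tau sx e e_pos e_lt e_tau e_c S0 A k V Loc) as [m Hm].
    exists (zigzag c tau sx e (S m)), bottom, (top tau sx), 0%nat.
    destruct (I (S m)) as (G & Hu & Hw); repeat (split; [assumption|]).
    intros n F; rewrite D; unfold bound_from; rewrite T5; fold sx.
    pose proof (Hm n F); unfold c in *; lra.
Qed.
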